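(* Let $g>0$, $\rho_+>\rho_->0$, $[\rho]:=\rho_+-\rho_->0$, $\mu_\pm>0$ and $B\in\mathbb{R}\setminus\{0\}$. For $\xi\in\mathbb{R}$ and $\lambda>0$ consider the problem (vertical magnetic field) of finding $\psi:[-1,1]\to\mathbb{R}$, whose restrictions to $[-1,0]$ and $[0,1]$ are $C^4$, such that on $(-1,0)\cup(0,1)$ $$-\lambda^2\rho(\xi^2\psi-\psi'')=\mu\lambda(\xi^4\psi-2\xi^2\psi''+\psi'''')+|B|^2(-\xi^2\psi''+\psi''''),$$ with the jump conditions $$\llbracket\psi\rrbracket=\llbracket\psi'\rrbracket=0,\qquad \llbracket\mu\lambda(\xi^2\psi+\psi'')+|B|^2\psi''\rrbracket=0,$$ $$\llbracket\mu\lambda(\psi'''-3\xi^2\psi')+|B|^2\psi'''\rrbracket=\llbracket\lambda^2\rho\psi'\rrbracket+g[\rho]\xi^2\psi(0),$$ and the boundary conditions $\psi(-1)=\psi(1)=\psi'(-1)=\psi'(1)=0$. Then: (i) if $|B|\ge|B|_c$, then for every $\xi\in\mathbb{R}$ there is no nontrivial solution $\psi$ with $\lambda>0$; (ii) if $|B|<|B|_c$, then for every $\xi\in\mathbb{R}$ with $|\xi|\le|\xi|_{vc}^B$ there is no nontrivial solution $\psi$ with $\lambda>0$; (iii) if $|B|<|B|_c$, then for every $\xi\in\mathbb{R}$ with $|\xi|>|\xi|^B_{vc}$ there exist $\lambda(\xi)>0$ and a solution $\psi=\psi(\xi,x_2)$ of the problem; moreover $\psi$ and $\lambda$ are even in $\xi$,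 $\psi$ is smooth when restricted to $(-1,0)$ or $(0,1)$, and $\psi(\xi,0)\neq0$.
   Context: Here $\rho(x_2)=\rho_+$ and $\mu(x_2)=\mu_+$ for $x_2\in(0,1)$, $\rho(x_2)=\rho_-$ and $\mu(x_2)=\mu_-$ for $x_2\in(-1,0)$; primes denote $d/dx_2$; for a piecewise function $f$, $\llbracket f\rrbracket:=f(0^+)-f(0^-)$ (limit from $(0,1)$ minus limit from $(-1,0)$). The critical magnetic number is defined by $|B|_c^2:=\sup\{ g[\rho]\psi(0)^2/\int_{-1}^1|\psi'|^2dx_2 : \psi\in H_0^1((-1,1)),\ \psi\ne0\}$. For $|B|<|B|_c$ the critical frequency is defined by $(|\xi|^B_{vc})^2:=\inf\Big\{\frac{|B|^2\int_{-1}^1|\psi''|^2dx_2}{g[\rho]\psi(0)^2-|B|^2\int_{-1}^1|\psi'|^2dx_2}:\ \psi\in H_0^2((-1,1)),\ g[\rho]\psi(0)^2-|B|^2\int_{-1}^1|\psi'|^2dx_2>0\Big\}$. This ODE problem arises from normal-mode solutions $e^{\lambda t}e^{ix_1\xi}$ of the linearized 2D viscous, zero-resistivity MHD two-fluid Rayleigh–Taylor problem in the slab $\mathbb{R}\times(-1,1)$ with heavier fluid on top and constant vertical magnetic field $(0,B)$. *)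

(* Defs.v *)
From HB Require Import structures.
From mathcomp Require Import all_boot all_order all_algebra.
From mathcomp Require Import all_classical all_reals all_analysis.
Set Implicit Arguments. Unset Strict Implicit. Unset Printing Implicit Defensive.
Import Order.TTheory GRing.Theory Num.Theory.
Import numFieldNormedType.Exports.
Local Open Scope classical_set_scope.
Local Open Scope ring_scope.

Section Defs.
Variable R : realType.

Notation leb := (@lebesgue_measure R).

Definition L2m11 (phi : R -> R) : Prop :=
  measurable_fun (`[-1, 1]%classic : set R) phi /\
  leb.-integrable (`[-1, 1]%classic : set R) (EFin \o (fun x => phi x ^+ 2)).

Definition Int (a b : R) (f : R -> R) : R := \int[leb]_(t in (`[a, b]%classic : set R)) f t.

(* psi (continuous representative) belongs to H^1_0((-1,1)) with weak
   derivative phi: psi(x) = int_{-1}^x phi on [-1,1], phi in L^2, psi(1)=0. *)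
Definition H01_with (psi phi : R -> R) : Prop :=
  L2m11 phi /\ (forall x, -1 <= x <= 1 -> psi x = Int (-1) x phi) /\ psi 1 = 0.

(* psi belongs to H^2_0((-1,1)) with psi' = eta, psi'' = phi:
   eta in H^1_0 with weak derivative phi, psi(x) = int_{-1}^x eta, psi(1)=0. *)
Definition H02_with (psi eta phi : R -> R) : Prop :=
  H01_with eta phi /\ (forall x, -1 <= x <= 1 -> psi x = Int (-1) x eta) /\ psi 1 = 0.

Definition nonzero_on_m11 (psi : R -> R) : Prop :=
  exists x, -1 <= x <= 1 /\ psi x != 0.

Definition Bc2 (g drho : R) : \bar R :=
  ereal_sup [set r%:E | r in
    [set r | exists psi phi, H01_with psi phi /\ nonzero_on_m11 psi /\
       r = g * drho * psi 0 ^+ 2 / Int (-1) 1 (fun x => phi x ^+ 2)]].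

Definition xivc2 (g drho B : R) : \bar R :=
  ereal_inf [set r%:E | r in
    [set r | exists psi eta phi, H02_with psi eta phi /\
       0 < g * drho * psi 0 ^+ 2 - `|B| ^+ 2 * Int (-1) 1 (fun x => eta x ^+ 2) /\
       r = `|B| ^+ 2 * Int (-1) 1 (fun x => phi x ^+ 2) /
           (g * drho * psi 0 ^+ 2 - `|B| ^+ 2 * Int (-1) 1 (fun x => eta x ^+ 2))]].

Definition C4 (f : R -> R) : Prop :=
  (forall n : nat, (n < 4)%N -> forall x, derivable (derive1n n f) x 1) /\
  continuous (derive1n 4 f).

Definition D (n : nat) (f : R -> R) : R -> R := derive1n n f.

Definition ode_at (rho mu B xi lam : R) (f : R -> R) (x : R) : Prop :=
  - lam ^+ 2 * rho * (xi ^+ 2 * f x - D 2 f x) =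
  mu * lam * (xi ^+ 4 * f x - 2 * xi ^+ 2 * D 2 f x + D 4 f x)
  + `|B| ^+ 2 * (- xi ^+ 2 * D 2 f x + D 4 f x).

(* psi : [-1,1] -> R (given as a function on R, only its values on [-1,1]
   matter) solves the vertical-field problem with parameters xi, lam.
   The restriction of psi to [0,1] (resp. [-1,0]) is C^4, encoded by a
   C^4 function fp (resp. fm) on R agreeing with psi there; one-sided
   derivatives at 0, +-1 are the derivatives of fp / fm. *)
Definition VSol (g rp rm mp mm B xi lam : R) (psi : R -> R) : Prop :=
  exists fp fm : R -> R,
    C4 fp /\ C4 fm /\
    (forall x, 0 <= x <= 1 -> psi x = fp x) /\
    (forall x, -1 <= x <= 0 -> psi x = fm x) /\
    (forall x, 0 < x < 1 -> ode_at rp mp B xi lam fp x) /\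
    (forall x, -1 < x < 0 -> ode_at rm mm B xi lam fm x) /\
    fp 0 - fm 0 = 0 /\
    D 1 fp 0 - D 1 fm 0 = 0 /\
    (mp * lam * (xi ^+ 2 * fp 0 + D 2 fp 0) + `|B| ^+ 2 * D 2 fp 0)
    - (mm * lam * (xi ^+ 2 * fm 0 + D 2 fm 0) + `|B| ^+ 2 * D 2 fm 0) = 0 /\
    (mp * lam * (D 3 fp 0 - 3 * xi ^+ 2 * D 1 fp 0) + `|B| ^+ 2 * D 3 fp 0)
    - (mm * lam * (D 3 fm 0 - 3 * xi ^+ 2 * D 1 fm 0) + `|B| ^+ 2 * D 3 fm 0)
    = (lam ^+ 2 * rp * D 1 fp 0 - lam ^+ 2 * rm * D 1 fm 0)
      + g * (rp - rm) * xi ^+ 2 * psi 0 /\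
    psi (-1) = 0 /\ psi 1 = 0 /\ D 1 fm (-1) = 0 /\ D 1 fp 1 = 0.

Definition smooth_on (a b : R) (f : R -> R) : Prop :=
  forall n : nat, forall x, a < x < b -> derivable (derive1n n f) x 1.

End Defs.

(* Main.v *)
Require Import Defs.
From HB Require Import structures.
From mathcomp Require Import all_boot all_order all_algebra.
From mathcomp Require Import all_classical all_reals all_analysis.
From mathcomp Require Import measurable_realfun ring lra.
Import Order.TTheory GRing.Theory Num.Theory.
Import numFieldNormedType.Exports.
Local Open Scope classical_set_scope.
Local Open Scope ring_scope.
Set Implicit Arguments. Unset Strict Implicit. Unset Printing Implicit Defensive.

(** Testing the equation against [psi] gives the energy identity
    [lam^2 K + lam V + |B|^2 M = g [rho] xi^2 psi(0)^2], whose three left-hand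
    forms are nonnegative; the definitions of the critical numbers contradict it
    unless [psi = 0].

    For existence, let [E_lam] be the bilinear form on the left.  For every
    [lam > 0] there is a nonzero [w] satisfying everything except the last jump
    condition, so that [E_lam(w, u) = k u(0)] for all [u] in [H^2_0], where [k] is
    the defect in that condition.  By Cauchy-Schwarz [w] then minimises
    [E_lam(u, u) / u(0)^2], with minimum [k / w(0)].  Take for [lam] the supremum
    of the rates at which [E_lam(u, u) < g [rho] xi^2 u(0)^2] for some [u]: as
    [E_lam(u, u)] is a quadratic polynomial in [lam] with nonnegative coefficients,
    the minimum is exactly [g [rho] xi^2] at this rate, which is the missing jump
    condition for [w]. *)

(** * Integrals on subintervals of [-1, 1] *)

Section Integrals.
Variable R : realType.
Implicit Types (f g : R -> R) (a b c x : R).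
Notation leb := (@lebesgue_measure R).
Notation I := (`[-1, 1]%classic : set R).

Definition L1m11 f := leb.-integrable I (EFin \o f).

Lemma L1_measurable f : L1m11 f -> measurable_fun I f.
Proof. by move=> /integrableP[/measurable_EFinP]. Qed.

Lemma L1_dominated f g : measurable_fun I f -> L1m11 g ->
  (forall x, -1 <= x <= 1 -> `|f x| <= g x) -> L1m11 f.
Proof.
move=> mf ig fg; apply: (le_integrable _ _ _ ig) => //.
- exact/measurable_EFinP.
- move=> x /=; rewrite in_itv /= => /fg h.
  by rewrite lee_fin (le_trans h)// ler_norm.
Qed.

Lemma L1D f g : L1m11 f -> L1m11 g -> L1m11 (fun x => f x + g x).
Proof. by move=> hf hg; apply: (integrableD _ hf hg). Qed.

Lemma L1Z c f : L1m11 f -> L1m11 (fun x => c * f x).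
Proof. by move=> hf; apply: (integrableZl _ c hf). Qed.

Lemma L1B f g : L1m11 f -> L1m11 g -> L1m11 (fun x => f x - g x).
Proof. by move=> hf hg; apply: (integrableB _ hf hg). Qed.

Lemma L1_norm f : L1m11 f -> L1m11 (fun x => `|f x|).
Proof. by move=> hf; apply: (integrable_norm hf). Qed.

Lemma L1_continuous f : {within I, continuous f} -> L1m11 f.
Proof.
by move=> cf; apply: continuous_compact_integrable => //; exact: segment_compact.
Qed.

Lemma L1_cst c : L1m11 (fun=> c).
Proof. by apply: L1_continuous; apply: continuous_subspaceT => x; exact: cst_continuous. Qed.

Lemma L2D f g : L2m11 f -> L2m11 g -> L2m11 (fun x => f x + g x).
Proof.
move=> [mf f2] [mg g2]; have m : measurable_fun I (fun x => f x + g x) by exact: measurable_funD.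
split=> //; apply: (@L1_dominated _ (fun x => 2 * f x ^+ 2 + 2 * g x ^+ 2)).
- exact: measurable_funX.
- by apply: L1D; apply: L1Z.
- move=> x _; rewrite ger0_norm ?sqr_ge0//; have := sqr_ge0 (f x - g x); nra.
Qed.

Lemma L2Z c f : L2m11 f -> L2m11 (fun x => c * f x).
Proof.
move=> [mf f2]; split; first exact: measurable_funM.
have := L1Z (c ^+ 2) f2; congr (L1m11 _).
by apply/funext => x; rewrite exprMn.
Qed.

Lemma L2B f g : L2m11 f -> L2m11 g -> L2m11 (fun x => f x - g x).
Proof.
move=> hf hg; have := L2D hf (L2Z (-1) hg); congr (L2m11 _).
by apply/funext => x; rewrite mulN1r.
Qed.

Lemma L2_mul f g : L2m11 f -> L2m11 g -> L1m11 (fun x => f x * g x).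
Proof.
move=> [mf f2] [mg g2]; apply: (@L1_dominated _ (fun x => f x ^+ 2 + g x ^+ 2)).
- exact: measurable_funM.
- exact: L1D.
- move=> x _; rewrite ler_norml; have := sqr_ge0 (f x - g x).
  have := sqr_ge0 (f x + g x); have := sqr_ge0 (f x); have := sqr_ge0 (g x).
  by move=> *; apply/andP; split; nra.
Qed.

Lemma L2_continuous f : {within I, continuous f} -> L2m11 f.
Proof.
move=> cf; split; first exact: L1_measurable (L1_continuous cf).
have h : {within I, continuous (f * f)}.
  by move=> x; apply: (@continuousM _ (subspace I) f f x); exact: cf.
exact: L1_continuous h.
Qed.

Lemma L2_continuousT f : continuous f -> L2m11 f.
Proof. by move=> cf; apply/L2_continuous/continuous_subspaceT. Qed.

Lemma L2_L1 f : L2m11 f -> L1m11 f.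
Proof.
move=> hf; have := L2_mul (L2_continuousT (@cst_continuous _ _ (1 : R))) hf.
by congr (L1m11 _); apply/funext => x; rewrite mul1r.
Qed.

(** Serves both the piecewise constant coefficients and the two-piece solutions with their
    derivatives. *)
Definition glue0 f g := fun x => if x <= 0 then f x else g x.

Lemma L2_glue f g : L2m11 f -> L2m11 g -> L2m11 (glue0 f g).
Proof.
move=> [mf f2] [mg g2].
have m : measurable_fun I (glue0 f g).
  apply: measurable_fun_if => //=.
  - by apply: measurable_fun_ler => //; exact: measurable_cst.
  - by apply: measurable_funS mf => // x [].
  - by apply: measurable_funS mg => // x [].
split=> //; apply: (@L1_dominated _ (fun x => f x ^+ 2 + g x ^+ 2)).
- exact: measurable_funX.
- exact: L1D.
- move=> x _; rewrite ger0_norm ?sqr_ge0// /glue0.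
  by case: ifP => _; rewrite ?lerDl ?lerDr sqr_ge0.
Qed.

Section bounds.
Variables a b : R.
Hypotheses (ha : -1 <= a) (hb : b <= 1).

Lemma L1_sub f : L1m11 f -> leb.-integrable (`[a, b]%classic : set R) (EFin \o f).
Proof.
move=> hf; apply: integrableS hf => //.
by apply: subset_itvScc; rewrite bnd_simp.
Qed.

Lemma IntD f g : L1m11 f -> L1m11 g ->
  Int a b (fun x => f x + g x) = Int a b f + Int a b g.
Proof. by move=> hf hg; apply: RintegralD => //; exact: L1_sub. Qed.

Lemma IntB f g : L1m11 f -> L1m11 g ->
  Int a b (fun x => f x - g x) = Int a b f - Int a b g.
Proof. by move=> hf hg; apply: RintegralB => //; exact: L1_sub. Qed.

Lemma IntZ c f : L1m11 f -> Int a b (fun x => c * f x) = c * Int a b f.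
Proof. by move=> hf; apply: RintegralZl => //; exact: L1_sub. Qed.

Lemma le_Int f g : L1m11 f -> L1m11 g ->
  (forall x, a <= x <= b -> f x <= g x) -> Int a b f <= Int a b g.
Proof.
move=> hf hg fg; apply: le_Rintegral => //; try exact: L1_sub.
Qed.

Lemma normr_Int f : L1m11 f -> `|Int a b f| <= Int a b (fun x => `|f x|).
Proof. by move=> hf; apply: le_normr_Rintegral => //; exact: L1_sub. Qed.

(** The endpoints are null. The open interval matters: the equation is given only there, and a glued
    function takes its left piece at 0. *)
Lemma Int_eq_oo f g : L1m11 f -> L1m11 g ->
  (forall x, a < x < b -> f x = g x) -> Int a b f = Int a b g.
Proof.
move=> hf hg fg; rewrite /Int /Rintegral; congr fine.
apply: eq_integral_itv_bounded.
- apply: measurable_funS (L1_measurable hf) => //.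
  by apply: subset_itvScc; rewrite bnd_simp.
- apply: measurable_funS (L1_measurable hg) => //.
  by apply: subset_itvScc; rewrite bnd_simp.
- by move=> x /[!inE]; exact: fg.
Qed.

Lemma Int_split c f : L1m11 f -> a <= c <= b ->
  Int a b f = Int a c f + Int c b f.
Proof.
move=> hf /andP[ac cb].
have := @Rintegral_itvB R f (BLeft a) (BRight b) c (L1_sub hf).
rewrite !bnd_simp => /(_ ac cb) H.
rewrite /Int -(@Rintegral_itv_obnd_cbnd R c (BRight b) f).
  by rewrite -H addrC subrK.
apply: integrableS hf => //.
by apply: subset_itvScc; rewrite bnd_simp//; apply: le_trans ac.
Qed.

End bounds.

Lemma Int_point a f : Int a a f = 0.
Proof. by rewrite /Int set_itv1 Rintegral_set1. Qed.

Lemma eq_Int a b f g : (forall x, a <= x <= b -> f x = g x) -> Int a b f = Int a b g.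
Proof. by move=> fg; apply: eq_Rintegral => x /[!inE]; exact: fg. Qed.

Lemma Int_ge0 a b f : (forall x, a <= x <= b -> 0 <= f x) -> 0 <= Int a b f.
Proof. by move=> f0; apply: Rintegral_ge0 => x; exact: f0. Qed.

Lemma Int_cst a b c : a <= b -> Int a b (fun=> c) = c * (b - a).
Proof.
move=> ab; rewrite /Int Rintegral_cst//.
congr (_ * _); transitivity (fine (lebesgue_measure [set` `[a, b]])) => //.
rewrite lebesgue_measure_itv /= lte_fin.
case: ltP => //= ba; have -> : a = b by apply: le_anti; rewrite ab.
by rewrite subrr.
Qed.

Lemma continuous_Int f : L1m11 f -> {within I, continuous (fun x => Int (-1) x f)}.
Proof. by move=> hf; apply: parameterized_integral_continuous. Qed.

Lemma Int_FTC f f' a b : a <= b -> (forall x, is_derive x 1 f (f' x)) ->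
  continuous f' -> Int a b f' = f b - f a.
Proof.
rewrite le_eqVlt => /predU1P[-> _ _|ab df cf]; first by rewrite Int_point subrr.
have cF : continuous f.
  by move=> x; apply/differentiable_continuous/derivable1_diffP.
rewrite /Int /Rintegral (@continuous_FTC2 _ f' f)//.
- exact: continuous_subspaceT.
- split; first by [].
  + exact: cvg_at_right_filter (cF a).
  + exact: cvg_at_left_filter (cF b).
- by move=> x _; rewrite derive1E derive_val.
Qed.

End Integrals.

(** * Integration by parts against absolutely continuous functions *)

Section ByParts.
Variable R : realType.
Implicit Types (f g : R -> R) (a b c x : R).
Notation I := (`[-1, 1]%classic : set R).

(* Bisecting [n] times improves the bound by a factor [2 ^ n]. *)
Lemma small_increments_const (P A : R -> R) (K a b : R) : a <= b ->
  (forall x y, a <= x -> x <= y -> y <= b ->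
     `|P y - P x| <= K * (y - x) * (A y - A x)) ->
  P b = P a.
Proof.
move=> ab H.
have dyadic n : forall x y, a <= x -> x <= y -> y <= b ->
    2 ^+ n * `|P y - P x| <= K * (y - x) * (A y - A x).
  elim: n => [|n IHn] x y ax xy yb; first by rewrite expr0 mul1r H.
  pose m := (x + y) / 2.
  have xm : x <= m by rewrite /m; lra.
  have my : m <= y by rewrite /m; lra.
  have H1 := IHn x m ax xm (le_trans my yb).
  have H2 := IHn m y (le_trans ax xm) my yb.
  have H3 : `|P y - P x| <= `|P y - P m| + `|P m - P x|.
    by rewrite -[P y - P x](subrKA (P m)) ler_normD.
  have p : 0 <= 2 ^+ n :> R by rewrite exprn_ge0.
  have H4 := ler_wpM2l p H3.
  (* Each half has half the length while the increments of [A] add up, so the bound gains a factor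
     2. *)
  have -> : K * (y - x) * (A y - A x) =
    2 * (K * (m - x) * (A m - A x) + K * (y - m) * (A y - A m)) by rewrite /m; field.
  by rewrite exprS; nra.
apply/eqP; rewrite -subr_eq0 -normr_eq0; apply: contraT => d0.
have d_gt0 : 0 < `|P b - P a| by rewrite lt_neqAle eq_sym d0 normr_ge0.
pose C := K * (b - a) * (A b - A a).
have C0 : 0 <= C / `|P b - P a|.
  by rewrite divr_ge0// (le_trans _ (H a b _ ab _)).
(* This [n], hence also [2 ^ n], exceeds the ratio of [C] to the increment of [P], against
   [dyadic]. *)
have := archi_boundP C0; set n := Num.bound _ => Cn.
have := dyadic n a b (lexx a) ab (lexx b); rewrite -ler_pdivlMr// => h.
have : (n%:R : R) <= 2 ^+ n by rewrite -natrX ler_nat ltnW// ltn_expl.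
by move=> /le_trans /(_ h); rewrite leNgt Cn.
Qed.

Lemma Int_normr_bound f M a b : -1 <= a -> a <= b -> b <= 1 -> L1m11 f ->
  (forall x, a <= x <= b -> `|f x| <= M) -> `|Int a b f| <= M * (b - a).
Proof.
move=> ha ab hb hf fM; rewrite -Int_cst//.
apply: (le_trans (normr_Int ha hb hf)); apply: le_Int => //.
- exact: L1_norm.
- exact: L1_cst.
Qed.

Lemma Int_le_sub f a b c d : -1 <= a -> a <= c -> c <= d -> d <= b -> b <= 1 ->
  L1m11 f -> (forall x, 0 <= f x) -> Int c d f <= Int a b f.
Proof.
move=> ha ac cd db hb hf f0.
rewrite (@Int_split R a b ha hb c)// ?ac ?(le_trans cd)//.
rewrite (@Int_split R c b _ hb d)// ?cd ?db//; last exact: le_trans ac.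
rewrite addrCA lerDl addr_ge0//; exact: Int_ge0.
Qed.

Lemma L2_primitive f g : L2m11 f -> (forall x, -1 <= x <= 1 -> g x = Int (-1) x f) -> L2m11 g.
Proof.
move=> hf gE; apply: L2_continuous.
have := continuous_Int (L2_L1 hf); apply: subspace_eq_continuous.
by move=> x /[!inE] xI; rewrite /from_subspace gE//; move: xI; rewrite /= in_itv.
Qed.

(** As [g] is only absolutely continuous, the fundamental theorem does not apply to [F * g]. Instead
    [P], the primitive of the integrand minus [F * g], has increments bounded by a constant times
    the length times the integral of the norm of [f], and is therefore constant. *)
Lemma Int_by_parts (F F' : R -> R) f g a b : -1 <= a -> a <= b -> b <= 1 ->
  (forall x, is_derive x 1 F (F' x)) -> continuous F' ->
  L2m11 f -> (forall x, -1 <= x <= 1 -> g x = Int (-1) x f) ->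
  Int a b (fun x => F' x * g x + F x * f x) = F b * g b - F a * g a.
Proof.
move=> ha ab hb dF cF' hf gE.
have cF : continuous F.
  by move=> x; apply/differentiable_continuous/derivable1_diffP.
have hF := L2_continuousT cF; have hF' := L2_continuousT cF'.
have hg := L2_primitive hf gE.
have hfn := L1_norm (L2_L1 hf).
have hh : L1m11 (fun x => F' x * g x + F x * f x) by apply: L1D; exact: L2_mul.
pose A x := Int (-1) x (fun t => `|f t|).
pose P x := Int (-1) x (fun x => F' x * g x + F x * f x) - F x * g x.
have N1 : -1 <= (1 : R) by lra.
have [M0 M0P] : exists M : R, forall x : R, -1 <= x <= 1 -> `|F' x| <= M.
  have [|c _ cP] := @EVT_max R (fun x => `|F' x|) (-1) 1 N1.
    by apply: continuous_subspaceT => x; apply: continuous_comp;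
      [exact: cF' | exact: norm_continuous].
  by exists `|F' c| => x hx; apply: cP; rewrite in_itv.
have step x y : -1 <= x -> x <= y -> y <= 1 ->
    `|P y - P x| <= (2 * M0) * (y - x) * (A y - A x).
  move=> x1 xy y1.
  have yl : -1 <= y by apply: le_trans xy.
  have sub f0 : L1m11 f0 -> forall s t : R, -1 <= s -> s <= t -> t <= 1 ->
      Int (-1) t f0 - Int (-1) s f0 = Int s t f0.
    move=> hf0 s t hs st ht.
    by rewrite (@Int_split R (-1) t _ ht s)// ?hs// addrAC subrr add0r.
  have gsub (s t : R) : -1 <= s -> s <= t -> t <= 1 -> g t - g s = Int s t f.
    move=> hs st ht; rewrite !gE ?hs ?ht ?(le_trans hs)//= ?(le_trans st)//.
    by rewrite sub//; exact: L2_L1.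
  have -> : A y - A x = Int x y (fun t => `|f t|) by rewrite sub.
  set D := Int x y (fun t => `|f t|).
  have -> : P y - P x = Int x y (fun t => F' t * (g t - g y) + (F t - F x) * f t).
    have -> : P y - P x = Int x y (fun x => F' x * g x + F x * f x)
        - ((F y - F x) * g y + F x * (g y - g x)).
      by rewrite -(sub _ hh)// /P; ring.
    rewrite gsub// -(Int_FTC xy dF cF') [_ * g y]mulrC.
    rewrite -(IntZ x1 y1 (g y) (L2_L1 hF')) -(IntZ x1 y1 (F x) (L2_L1 hf)).
    rewrite -IntD//; [|exact/L1Z/L2_L1..].
    rewrite -IntB//; last by apply: L1D; exact/L1Z/L2_L1.
    by apply: eq_Int => t _; ring.
  have H : L1m11 (fun t => F' t * (g t - g y) + (F t - F x) * f t).
    apply: L1D; apply: L2_mul => //; apply: L2B => //;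
      by apply: L2_continuousT => ?; exact: cst_continuous.
  apply: (le_trans (normr_Int x1 y1 H)).
  (* On [[x, y]], [g] stays within [D] of [g y] and [F] within [M0 * (y - x)] of [F x]; the two
     terms contribute equally. *)
  have -> : 2 * M0 * (y - x) * D = Int x y (fun t => M0 * D + (M0 * (y - x)) * `|f t|).
    rewrite IntD//; [|exact: L1_cst|exact: L1Z].
    by rewrite Int_cst// IntZ// -/D; ring.
  have M00 : 0 <= M0 by apply: le_trans (M0P 0 _); rewrite ?normr_ge0//; lra.
  apply: le_Int => //; [exact: L1_norm| apply: L1D; [exact: L1_cst|exact: L1Z]|].
  move=> t /andP[xt ty]; apply: (le_trans (ler_normD _ _)); apply: lerD.
    rewrite normrM ler_pM// ?M0P ?(le_trans x1)//= ?(le_trans ty)//.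
    have t1 : -1 <= t by exact: le_trans xt.
    rewrite distrC gsub//; apply: (le_trans (normr_Int t1 y1 (L2_L1 hf))).
    exact: Int_le_sub.
  rewrite normrM ler_wpM2r// -(Int_FTC xt dF cF').
  have t1 : t <= 1 by exact: le_trans y1.
  apply: (@le_trans _ _ (M0 * (t - x))); last by rewrite ler_wpM2l// lerB.
  apply: Int_normr_bound => //; first exact: L2_L1.
  by move=> s /andP[xs st]; apply: M0P; rewrite (le_trans x1)//= (le_trans st).
have := @small_increments_const P A (2 * M0) a b ab.
rewrite /P (@Int_split R (-1) b _ hb a)// ?ha// => H.
have {}H := H (fun x y ax xy yb => step x y (le_trans ha ax) xy (le_trans yb hb)).
by lra.
Qed.

End ByParts.

(** * Boundary values and Cauchy-Schwarz bounds in the energy space *)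

Section Triples.
Variable R : realType.
Implicit Types (psi eta phi : R -> R).

Lemma H02_L2 psi eta phi : H02_with psi eta phi -> [/\ L2m11 psi, L2m11 eta & L2m11 phi].
Proof.
move=> [[hphi [etaE _]] [psiE _]].
have heta := L2_primitive hphi etaE.
by split=> //; exact: L2_primitive psiE.
Qed.

Lemma H02_bnd psi eta phi : H02_with psi eta phi ->
  [/\ psi (-1) = 0, psi 1 = 0, eta (-1) = 0 & eta 1 = 0].
Proof.
move=> [[_ [etaE eta1]] [psiE psi1]]; split=> //.
  by rewrite psiE ?Int_point//; lra.
by rewrite etaE ?Int_point//; lra.
Qed.

(** Cauchy-Schwarz against the constant 1: integrate [(eta x - s) ^+ 2 >= 0] with [s] the mean of
    [eta]. *)
Lemma sqr_Int_le eta a b : -1 <= a -> a <= b -> b <= 1 -> L2m11 eta ->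
  (Int a b eta) ^+ 2 <= (b - a) * Int a b (fun x => eta x ^+ 2).
Proof.
move=> ha ab hb he.
have he2 : L1m11 (fun x => eta x ^+ 2) by case: he.
have E0 : 0 <= Int a b (fun x => eta x ^+ 2) by apply: Int_ge0 => x _; exact: sqr_ge0.
have [<-|/eqP ba] := eqVneq a b; first by rewrite !Int_point expr0n mulr0.
have {}ba : 0 < b - a by rewrite subr_gt0 lt_neqAle ab andbT; apply/eqP.
set s := Int a b eta / (b - a).
have : Int a b (fun x => 2 * s * eta x) <= Int a b (fun x => eta x ^+ 2 + s ^+ 2).
  apply: le_Int => //; first exact/L1Z/L2_L1.
  - by apply: L1D => //; exact: L1_cst.
  - by move=> x _; have := sqr_ge0 (eta x - s); nra.
rewrite IntZ//; last exact: L2_L1.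
rewrite IntD// ?Int_cst//; last exact: L1_cst.
have sE : Int a b eta = s * (b - a) by rewrite /s divfK// gt_eqF.
rewrite sE => h; nra.
Qed.

(** Cauchy-Schwarz on [[-1, x]]. *)
Lemma primitive_eq0 psi eta : L2m11 eta ->
  (forall x, -1 <= x <= 1 -> psi x = Int (-1) x eta) ->
  Int (-1) 1 (fun x => eta x ^+ 2) <= 0 -> forall x, -1 <= x <= 1 -> psi x = 0.
Proof.
move=> he psiE E0 x /andP[x1 x2]; rewrite psiE ?x1//.
have := sqr_Int_le (lexx _) x1 x2 he.
have := Int_le_sub (lexx _) (lexx _) x1 x2 (lexx _) he.2 (fun x => sqr_ge0 (eta x)).
move=> h1 h2; apply/eqP; rewrite -sqrf_eq0 eq_le sqr_ge0 andbT.
by apply: (le_trans h2); rewrite mulr_ge0_le0// ?(le_trans h1)//; lra.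
Qed.

(** Cauchy-Schwarz on [[-1, 0]], of length 1. It serves to bound the growth rates from above. *)
Lemma sqr_origin_le psi eta phi : H02_with psi eta phi ->
  psi 0 ^+ 2 <= Int (-1) 1 (fun x => eta x ^+ 2).
Proof.
move=> h; have [_ he _] := H02_L2 h.
have z1 : -1 <= (0 : R) by lra.
have z2 : (0 : R) <= 1 by lra.
case: h => _ [psiE _]; rewrite psiE ?z1//.
apply: (le_trans (sqr_Int_le (lexx _) z1 z2 he)); rewrite opprK add0r mul1r.
exact: Int_le_sub (lexx _) (lexx _) z1 z2 (lexx _) he.2 (fun x => sqr_ge0 (eta x)).
Qed.

End Triples.

(** * The energy form *)

Section Forms.
Variable R : realType.
Implicit Types (f g u w psi eta phi : R -> R) (p m : nat -> R -> R).
Implicit Types (a b c d x xi lam t r k rp rm mp mm : R).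

(** Used for density and viscosity; the value of the lower layer comes first. *)
Definition step c d : R -> R := glue0 (fun=> c) (fun=> d).

Lemma L1_step c d f : L1m11 f -> L1m11 (fun x => step c d x * f x).
Proof.
move=> hf.
have cc (e : R) : L2m11 (fun=> e) by apply: L2_continuousT => ?; exact: cst_continuous.
apply: (@L1_dominated _ _ (fun x => (`|c| + `|d|) * `|f x|)).
- apply: measurable_funM; last exact: L1_measurable.
  exact: (L2_glue (cc c) (cc d)).1.
- exact/L1Z/L1_norm.
- move=> x _; rewrite normrM ler_wpM2r// /step /glue0.
  by case: ifP => _; rewrite ?lerDl ?lerDr.
Qed.

Lemma step_bound c d x : 0 < c -> c < d -> c <= step c d x.
Proof. by move=> c0 cd; rewrite /step /glue0; case: ifP => // _; exact: ltW. Qed.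

Lemma step_ge0 c d x : 0 < c -> 0 < d -> 0 <= step c d x.
Proof. by move=> c0 d0; rewrite /step /glue0; case: ifP => _; exact: ltW. Qed.

(** The forms take derivatives as separate arguments because an element of $H^2_0$ carries its weak
    derivatives as data. *)
Definition kinetic (rho : R -> R) xi w w1 u u1 :=
  Int (-1) 1 (fun x => rho x * (xi ^+ 2 * (w x * u x) + w1 x * u1 x)).

(** This grouping of the integrand makes the natural interface terms of the weak form those whose
    jumps the problem prescribes. *)
Definition viscous (mu : R -> R) xi w w1 w2 u u1 u2 :=
  Int (-1) 1 (fun x => mu x * ((xi ^+ 2 * w x + w2 x) * (xi ^+ 2 * u x + u2 x)
                               + 4 * xi ^+ 2 * (w1 x * u1 x))).

Definition magnetic xi w1 w2 u1 u2 :=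
  Int (-1) 1 (fun x => xi ^+ 2 * (w1 x * u1 x) + w2 x * u2 x).

Definition energy rp rm mp mm (B2 : R) xi lam w w1 w2 u u1 u2 :=
  lam ^+ 2 * kinetic (step rm rp) xi w w1 u u1
  + lam * viscous (step mm mp) xi w w1 w2 u u1 u2
  + B2 * magnetic xi w1 w2 u1 u2.

Lemma L1_kinetic c d xi w w1 u u1 : L2m11 w -> L2m11 w1 -> L2m11 u -> L2m11 u1 ->
  L1m11 (fun x => step c d x * (xi ^+ 2 * (w x * u x) + w1 x * u1 x)).
Proof. by move=> *; apply: L1_step; apply: L1D; [apply: L1Z|]; exact: L2_mul. Qed.

Lemma L1_viscous c d xi w w1 w2 u u1 u2 : L2m11 w -> L2m11 w1 -> L2m11 w2 ->
  L2m11 u -> L2m11 u1 -> L2m11 u2 ->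
  L1m11 (fun x => step c d x * ((xi ^+ 2 * w x + w2 x) * (xi ^+ 2 * u x + u2 x)
                               + 4 * xi ^+ 2 * (w1 x * u1 x))).
Proof.
move=> *; apply: L1_step; apply: L1D; last by apply: L1Z; exact: L2_mul.
by apply: L2_mul; apply: L2D => //; exact: L2Z.
Qed.

Lemma L1_magnetic xi w1 w2 u1 u2 : L2m11 w1 -> L2m11 w2 -> L2m11 u1 -> L2m11 u2 ->
  L1m11 (fun x => xi ^+ 2 * (w1 x * u1 x) + w2 x * u2 x).
Proof. by move=> *; apply: L1D; [apply: L1Z|]; exact: L2_mul. Qed.

Lemma Int_quadratic t f g u w : L1m11 f -> L1m11 g -> L1m11 u ->
  (forall x, w x = f x - 2 * t * g x + t ^+ 2 * u x) ->
  Int (-1) 1 w = Int (-1) 1 f - 2 * t * Int (-1) 1 g + t ^+ 2 * Int (-1) 1 u.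
Proof.
move=> hf hg hu wE.
have tg := L1Z (2 * t) hg; have tu := L1Z (t ^+ 2) hu.
transitivity (Int (-1) 1 (fun x => f x - 2 * t * g x + t ^+ 2 * u x)).
  by apply: eq_Int => x _.
by rewrite IntD ?IntB ?IntZ//; exact: L1B.
Qed.

Section energy_properties.
Variables (rp rm mp mm B2 xi lam : R).
Hypotheses (rm0 : 0 < rm) (rmp : rm < rp) (mp0 : 0 < mp) (mm0 : 0 < mm) (B20 : 0 < B2).
Let E := energy rp rm mp mm B2 xi.

Lemma kinetic_ge w w1 : L2m11 w -> L2m11 w1 ->
  rm * Int (-1) 1 (fun x => w1 x ^+ 2) <= kinetic (step rm rp) xi w w1 w w1.
Proof.
move=> hw hw1; rewrite -(IntZ (lexx _) (lexx _))//; last exact: hw1.2.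
apply: le_Int => //; [exact: L1Z hw1.2 | exact: L1_kinetic |].
move=> x _; apply: ler_pM => //; [exact: ltW|exact: sqr_ge0|exact: step_bound|].
by rewrite -[w1 x * w1 x]expr2 lerDr -expr2 mulr_ge0// sqr_ge0.
Qed.

Lemma kinetic_ge0 w w1 : 0 <= kinetic (step rm rp) xi w w1 w w1.
Proof.
apply: Int_ge0 => x _; apply: mulr_ge0; first by apply: step_ge0 => //; exact: lt_trans rmp.
by apply: addr_ge0; [apply: mulr_ge0; [exact: sqr_ge0|]|]; rewrite -expr2 sqr_ge0.
Qed.

Lemma viscous_ge0 w w1 w2 : 0 <= viscous (step mm mp) xi w w1 w2 w w1 w2.
Proof.
apply: Int_ge0 => x _; apply: mulr_ge0; first exact: step_ge0.
apply: addr_ge0; first by rewrite -expr2 sqr_ge0.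
apply: mulr_ge0; last by rewrite -expr2 sqr_ge0.
by rewrite mulr_ge0// sqr_ge0.
Qed.

Lemma magnetic_ge0 w1 w2 : 0 <= magnetic xi w1 w2 w1 w2.
Proof. apply: Int_ge0 => x _.
by apply: addr_ge0; [apply: mulr_ge0; [exact: sqr_ge0|]|]; rewrite -expr2 sqr_ge0. Qed.

(** The kinetic part alone gives coercivity for positive rates; definiteness of the form and the
    bound on growth rates both rest on it. *)
Lemma energy_ge w w1 w2 : 0 <= lam -> L2m11 w -> L2m11 w1 ->
  lam ^+ 2 * (rm * Int (-1) 1 (fun x => w1 x ^+ 2)) <= E lam w w1 w2 w w1 w2.
Proof.
move=> lam0 hw hw1; rewrite /E /energy -addrA -[leLHS]addr0 lerD//.
  by rewrite ler_wpM2l ?sqr_ge0// kinetic_ge.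
by rewrite addr_ge0// mulr_ge0// ?viscous_ge0 ?magnetic_ge0// ltW.
Qed.

Lemma energy_ge0 w w1 w2 : 0 <= lam -> 0 <= E lam w w1 w2 w w1 w2.
Proof.
move=> lam0; rewrite /E /energy !addr_ge0// mulr_ge0// ?sqr_ge0//.
- exact: kinetic_ge0.
- exact: viscous_ge0.
- exact: ltW.
- exact: magnetic_ge0.
Qed.

(** With [t] chosen so that [v] vanishes at the interface, this expansion is the Cauchy-Schwarz step
    of the minimisation. *)
Lemma energy_sub t w w1 w2 u u1 u2 : L2m11 w -> L2m11 w1 -> L2m11 w2 ->
  L2m11 u -> L2m11 u1 -> L2m11 u2 ->
  let v := fun x => u x - t * w x in
  let v1 := fun x => u1 x - t * w1 x in
  let v2 := fun x => u2 x - t * w2 x in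
  E lam v v1 v2 v v1 v2 = E lam u u1 u2 u u1 u2 - 2 * t * E lam w w1 w2 u u1 u2
     + t ^+ 2 * E lam w w1 w2 w w1 w2.
Proof.
move=> hw hw1 hw2 hu hu1 hu2 v v1 v2; rewrite /E /energy.
have -> : kinetic (step rm rp) xi v v1 v v1 = kinetic (step rm rp) xi u u1 u u1
    - 2 * t * kinetic (step rm rp) xi w w1 u u1
    + t ^+ 2 * kinetic (step rm rp) xi w w1 w w1.
  apply: Int_quadratic => [|||x]; [exact: L1_kinetic..|rewrite /v /v1; ring].
have -> : viscous (step mm mp) xi v v1 v2 v v1 v2 =
    viscous (step mm mp) xi u u1 u2 u u1 u2
    - 2 * t * viscous (step mm mp) xi w w1 w2 u u1 u2
    + t ^+ 2 * viscous (step mm mp) xi w w1 w2 w w1 w2.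
  apply: Int_quadratic => [|||x]; [exact: L1_viscous..|rewrite /v /v1 /v2; ring].
have -> : magnetic xi v1 v2 v1 v2 = magnetic xi u1 u2 u1 u2
    - 2 * t * magnetic xi w1 w2 u1 u2 + t ^+ 2 * magnetic xi w1 w2 w1 w2.
  apply: Int_quadratic => [|||x]; [exact: L1_magnetic..|rewrite /v1 /v2; ring].
by ring.
Qed.

End energy_properties.

(** [p n] stands for the derivative of order [n] of one function, with the $C^4$ regularity of a
    solution on one side. *)
Definition jet4 (p : nat -> R -> R) :=
  (forall n, (n < 4)%N -> forall x, is_derive x 1 (p n) (p n.+1 x)) /\ continuous (p 4%N).

Lemma is_derive_lin c d f g x df dg : is_derive x 1 f df -> is_derive x 1 g dg ->
  is_derive x 1 (fun y => c * f y + d * g y) (c * df + d * dg).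
Proof. by move=> hf hg; exact: (is_deriveD (is_deriveZ c hf) (is_deriveZ d hg)). Qed.

Lemma continuous_lin c d f g : continuous f -> continuous g ->
  continuous (fun x => c * f x + d * g x).
Proof.
move=> cf cg x; apply: cvgD; apply: cvgM.
- exact: cvg_cst.
- exact: cf.
- exact: cvg_cst.
- exact: cg.
Qed.

Lemma jet4_continuous p n : jet4 p -> (n <= 4)%N -> continuous (p n).
Proof.
move=> [dp c4]; rewrite leq_eqVlt => /predU1P[->//|n4] x.
by have := dp _ n4 x => ?; apply/differentiable_continuous/derivable1_diffP.
Qed.

Definition ode r k (B2 : R) xi lam (p : nat -> R -> R) x :=
  - lam ^+ 2 * r * (xi ^+ 2 * p 0%N x - p 2%N x) =
  k * lam * (xi ^+ 4 * p 0%N x - 2 * xi ^+ 2 * p 2%N x + p 4%N x)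
  + B2 * (- xi ^+ 2 * p 2%N x + p 4%N x).

Definition moment k (B2 : R) xi lam (p : nat -> R -> R) x :=
  lam * k * (xi ^+ 2 * p 0%N x + p 2%N x) + B2 * p 2%N x.

(** The inertial term of the last jump condition is moved to the left, so the condition says that
    [force] jumps by $g[\rho]\xi^2\psi(0)$. *)
Definition force r k (B2 : R) xi lam (p : nat -> R -> R) x :=
  (k * lam + B2) * p 3%N x - (3 * k * lam * xi ^+ 2 + lam ^+ 2 * r) * p 1%N x.

(* The integrand of the bilinear form is, by the equation, the derivative of
   [moment * eta - (force - B2 xi^2 p') * psi]. *)
Lemma weak_form_half r k (B2 : R) xi lam p psi eta phi a b :
  -1 <= a -> a <= b -> b <= 1 -> jet4 p ->
  (forall x, a < x < b -> ode r k B2 xi lam p x) -> H02_with psi eta phi ->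
  Int a b (fun x => lam ^+ 2 * (r * (xi ^+ 2 * (p 0%N x * psi x) + p 1%N x * eta x))
    + lam * (k * ((xi ^+ 2 * p 0%N x + p 2%N x) * (xi ^+ 2 * psi x + phi x)
                  + 4 * xi ^+ 2 * (p 1%N x * eta x)))
    + B2 * (xi ^+ 2 * (p 1%N x * eta x) + p 2%N x * phi x)) =
  (moment k B2 xi lam p b * eta b
    - (force r k B2 xi lam p b - B2 * xi ^+ 2 * p 1%N b) * psi b)
  - (moment k B2 xi lam p a * eta a
    - (force r k B2 xi lam p a - B2 * xi ^+ 2 * p 1%N a) * psi a).
Proof.
move=> ha ab hb jp odep hu; have [hpsi heta hphi] := H02_L2 hu.
case: hu => [[_ [etaE _]] [psiE _]].
pose al := - (k * lam + B2).
pose be := 3 * k * lam * xi ^+ 2 + lam ^+ 2 * r + B2 * xi ^+ 2.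
(* [G] is the opposite of [force] corrected by the magnetic term, and [H] below is [moment]. *)
pose G x := be * p 1%N x + al * p 3%N x.
pose G' x := be * p 2%N x + al * p 4%N x.
pose H x := lam * k * xi ^+ 2 * p 0%N x + (- al) * p 2%N x.
pose H' x := lam * k * xi ^+ 2 * p 1%N x + (- al) * p 3%N x.
have cp n : (n <= 4)%N -> continuous (p n) by exact: jet4_continuous.
have [dp _] := jp.
have dG x : is_derive x 1 G (G' x) by apply: is_derive_lin; exact: dp.
have dH x : is_derive x 1 H (H' x) by apply: is_derive_lin; exact: dp.
have cG' : continuous G' by apply: continuous_lin; exact: cp.
have cH' : continuous H' by apply: continuous_lin; exact: cp.
have cH : continuous H by apply: continuous_lin; exact: cp.
have cG : continuous G by apply: continuous_lin; exact: cp.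
have I1 := Int_by_parts ha ab hb dG cG' heta psiE.
have I2 := Int_by_parts ha ab hb dH cH' hphi etaE.
have L1a : L1m11 (fun x => G' x * psi x + G x * eta x).
  by apply: L1D; apply: L2_mul => //; exact: L2_continuousT.
have L1b : L1m11 (fun x => H' x * eta x + H x * phi x).
  by apply: L1D; apply: L2_mul => //; exact: L2_continuousT.
transitivity (Int a b (fun x => (G' x * psi x + G x * eta x) + (H' x * eta x + H x * phi x))).
  have Lp n : (n <= 4)%N -> L2m11 (p n) by move=> ?; apply: L2_continuousT; exact: cp.
  apply: Int_eq_oo => //; last 2 first.
  - exact: L1D.
  - move=> x /odep; rewrite /ode /G' /G /H' /H /be /al => e.
    move/eqP: e; rewrite -subr_eq0 => /eqP e.
    (* The two integrands differ by the residual of the equation times [psi x]. *)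
    by rewrite -[LHS]addr0 -(mul0r (psi x)) -e; ring.
  - have [h0 h1 h2] : [/\ L2m11 (p 0%N), L2m11 (p 1%N) & L2m11 (p 2%N)] by split; exact: Lp.
    apply: L1D; [apply: L1D; apply: L1Z; apply: L1Z; apply: L1D|apply: L1Z; apply: L1D].
    + exact/L1Z/L2_mul.
    + exact: L2_mul.
    + by apply: L2_mul; apply: L2D => //; exact: L2Z.
    + exact/L1Z/L2_mul.
    + exact/L1Z/L2_mul.
    + exact: L2_mul.
rewrite IntD// I1 I2 /G /H /moment /force /al /be; ring.
Qed.

Lemma L2_jet p n : jet4 p -> (n <= 4)%N -> L2m11 (p n).
Proof. by move=> jp n4; apply: L2_continuousT; exact: jet4_continuous jp n4. Qed.

Lemma glue0_pos f g x : 0 < x -> glue0 f g x = g x.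
Proof. by move=> x0; rewrite /glue0 leNgt x0. Qed.

Lemma glue0_neg f g x : x <= 0 -> glue0 f g x = f x.
Proof. by rewrite /glue0 => ->. Qed.

(** Add the two halves: the terms at -1 and 1 vanish with the test function, and at 0 the moments
    and the magnetic corrections cancel, leaving the jump of [force]. *)
Lemma weak_form rp rm mp mm (B2 : R) xi lam p m psi eta phi : jet4 p -> jet4 m ->
  (forall x, 0 < x < 1 -> ode rp mp B2 xi lam p x) ->
  (forall x, -1 < x < 0 -> ode rm mm B2 xi lam m x) ->
  p 1%N 0 = m 1%N 0 -> moment mp B2 xi lam p 0 = moment mm B2 xi lam m 0 ->
  H02_with psi eta phi ->
  energy rp rm mp mm B2 xi lam (glue0 (m 0%N) (p 0%N)) (glue0 (m 1%N) (p 1%N))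
    (glue0 (m 2%N) (p 2%N)) psi eta phi =
  (force rp mp B2 xi lam p 0 - force rm mm B2 xi lam m 0) * psi 0.
Proof.
move=> jp jm odep odem pm1 pm2 hu.
have [hpsi heta hphi] := H02_L2 hu; have [psiN psi1 etaN eta1] := H02_bnd hu.
have w0 : L2m11 (glue0 (m 0%N) (p 0%N)) by apply: L2_glue; exact: L2_jet.
have w1 : L2m11 (glue0 (m 1%N) (p 1%N)) by apply: L2_glue; exact: L2_jet.
have w2 : L2m11 (glue0 (m 2%N) (p 2%N)) by apply: L2_glue; exact: L2_jet.
have z1 : -1 <= (0 : R) by lra.
have z2 : (0 : R) <= 1 by lra.
have k1 := L1_kinetic rm rp xi w0 w1 hpsi heta.
have k2 := L1_viscous mm mp xi w0 w1 w2 hpsi heta hphi.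
have k3 := L1_magnetic xi w1 w2 heta hphi.
have l1 := L1Z (lam ^+ 2) k1; have l2 := L1Z lam k2; have l3 := L1Z B2 k3.
have l12 := L1D l1 l2; have l := L1D l12 l3.
rewrite /energy /kinetic /viscous /magnetic.
rewrite -(IntZ (lexx _) (lexx _) _ k1) -(IntZ (lexx _) (lexx _) _ k2).
rewrite -(IntZ (lexx _) (lexx _) _ k3).
rewrite -(IntD (lexx _) (lexx _) l1 l2) -(IntD (lexx _) (lexx _) l12 l3).
rewrite (Int_split (lexx _) (lexx _) (c := 0) l) ?z1//.
(* One statement for both sides: [q] is the piece on [[a, b]], which agrees with the glued data
   inside the interval. *)
have half r k q a b : -1 <= a -> a <= b -> b <= 1 -> jet4 q ->
    (forall x, a < x < b -> ode r k B2 xi lam q x) ->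
    (forall x, a < x < b -> [/\ step rm rp x = r, step mm mp x = k,
      glue0 (m 0%N) (p 0%N) x = q 0%N x, glue0 (m 1%N) (p 1%N) x = q 1%N x &
      glue0 (m 2%N) (p 2%N) x = q 2%N x]) ->
    Int a b (fun x => lam ^+ 2 * (step rm rp x * (xi ^+ 2 * (glue0 (m 0%N) (p 0%N) x * psi x)
        + glue0 (m 1%N) (p 1%N) x * eta x))
      + lam * (step mm mp x * ((xi ^+ 2 * glue0 (m 0%N) (p 0%N) x + glue0 (m 2%N) (p 2%N) x)
          * (xi ^+ 2 * psi x + phi x) + 4 * xi ^+ 2 * (glue0 (m 1%N) (p 1%N) x * eta x)))
      + B2 * (xi ^+ 2 * (glue0 (m 1%N) (p 1%N) x * eta x) + glue0 (m 2%N) (p 2%N) x * phi x)) =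
    (moment k B2 xi lam q b * eta b
      - (force r k B2 xi lam q b - B2 * xi ^+ 2 * q 1%N b) * psi b)
    - (moment k B2 xi lam q a * eta a
      - (force r k B2 xi lam q a - B2 * xi ^+ 2 * q 1%N a) * psi a).
  move=> ha ab hb jq odeq E; rewrite -(weak_form_half ha ab hb jq odeq hu).
  have [q0 q1 q2] : [/\ L2m11 (q 0%N), L2m11 (q 1%N) & L2m11 (q 2%N)] by split; exact: L2_jet.
  apply: Int_eq_oo => //.
  - apply: L1D; [apply: L1D; apply: L1Z; apply: L1Z; apply: L1D|apply: L1Z; apply: L1D].
    + exact/L1Z/L2_mul.
    + exact: L2_mul.
    + by apply: L2_mul; apply: L2D => //; exact: L2Z.
    + exact/L1Z/L2_mul.
    + exact/L1Z/L2_mul.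
    + exact: L2_mul.
  - by move=> x /E[-> -> -> -> ->].
rewrite (half rm mm m)//; last first.
  by move=> x /andP[_ /ltW x0]; rewrite /step !glue0_neg.
rewrite (half rp mp p)//; last first.
  by move=> x /andP[x0 _]; rewrite /step !glue0_pos.
by rewrite psiN psi1 etaN eta1 pm1 pm2; ring.
Qed.

(** The fundamental theorem on each side; continuity at 0 matches the constants. *)
Lemma glue0_primitive f f' g g' : (forall x, is_derive x 1 f (f' x)) -> continuous f' ->
  (forall x, is_derive x 1 g (g' x)) -> continuous g' -> f (-1) = 0 -> f 0 = g 0 ->
  forall x, -1 <= x <= 1 -> glue0 f g x = Int (-1) x (glue0 f' g').
Proof.
move=> df cf dg cg f1 fg x /andP[x1 x2].
have hh : L1m11 (glue0 f' g').
  by apply: L2_L1; apply: L2_glue; exact: L2_continuousT.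
have left y : -1 <= y -> y <= 0 -> Int (-1) y (glue0 f' g') = f y.
  move=> y1 y0; rewrite -[RHS]subr0 -f1 -(Int_FTC y1 df cf).
  by apply: eq_Int => z /andP[_ zy]; rewrite glue0_neg// (le_trans zy).
have [x0|x0] := leP x 0; first by rewrite glue0_neg// left.
rewrite glue0_pos// (Int_split (lexx _) x2 (c := 0) hh); last by rewrite ltW ?andbT//; lra.
rewrite left//.
rewrite -[LHS](subrK (g 0)) -(Int_FTC (ltW x0) dg cg) fg addrC; congr (_ + _).
apply: Int_eq_oo => //.
- by apply: L2_L1; exact: L2_continuousT.
- by move=> z /andP[z0 _]; rewrite glue0_pos.
Qed.

(** Value and slope match at the interface, so the previous lemma applies at orders 0 and 1. The
    second derivative may jump, being only required in $L^2$. *)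
Lemma H02_glue p m : jet4 p -> jet4 m -> p 0%N 0 = m 0%N 0 -> p 1%N 0 = m 1%N 0 ->
  m 0%N (-1) = 0 -> m 1%N (-1) = 0 -> p 0%N 1 = 0 -> p 1%N 1 = 0 ->
  H02_with (glue0 (m 0%N) (p 0%N)) (glue0 (m 1%N) (p 1%N)) (glue0 (m 2%N) (p 2%N)).
Proof.
move=> jp jm e0 e1 m0 m1 p0 p1.
have o0 : (0 : R) < 1 by lra.
have prim n : (n < 2)%N -> m n (-1) = 0 -> p n 0 = m n 0 ->
    forall x, -1 <= x <= 1 -> glue0 (m n) (p n) x = Int (-1) x (glue0 (m n.+1) (p n.+1)).
  move=> n2 mn en; apply: glue0_primitive => //.
  - by move=> x; apply: jm.1; exact: ltn_trans n2 _.
  - by apply: (jet4_continuous jm); exact: leq_trans n2 _.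
  - by move=> x; apply: jp.1; exact: ltn_trans n2 _.
  - by apply: (jet4_continuous jp); exact: leq_trans n2 _.
split; [split|split].
- by apply: L2_glue; exact: L2_jet.
- by split; [exact: prim | rewrite glue0_pos].
- exact: prim.
- by rewrite glue0_pos.
Qed.

End Forms.

(** * Solutions with constant coefficients *)

Section Jets.
Variable R : realType.
Implicit Types (d e : nat -> R -> R) (r s q x : R).

(** A smooth function with all its derivatives; linear combinations, shifts and translations are
    then taken termwise. *)
Definition jet d := forall n x, is_derive x 1 (d n) (d n.+1 x).

Lemma jet_jet4 d : jet d -> jet4 d.
Proof.
move=> jd; split=> // x.
by have := jd 4%N x => ?; apply/differentiable_continuous/derivable1_diffP.
Qed.

Lemma jet_continuous d n : jet d -> continuous (d n).
Proof.
by move=> jd x; have := jd n x => ?; apply/differentiable_continuous/derivable1_diffP.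
Qed.

Lemma jet_lin r s d e : jet d -> jet e -> jet (fun n x => r * d n x + s * e n x).
Proof. by move=> jd je n x; exact: is_derive_lin. Qed.

Lemma jet_shift d : jet d -> jet (fun n => d n.+1).
Proof. by move=> jd n; exact: jd. Qed.

Lemma jet_translate r d : jet d -> jet (fun n x => d n (x + r)).
Proof.
move=> jd n x; have h := jd n (x + r).
have e : is_derive x 1 (fun x => x + r) (1 : R).
  by have := is_deriveD (is_derive_id x 1) (is_derive_cst r x 1); rewrite addr0.
by have := @is_derive1_comp R (d n) (fun x => x + r) x _ _ h e; rewrite mulr1.
Qed.

Definition expj r : nat -> R -> R := fun n x => r ^+ n * expR (r * x).

Lemma is_derive_expM r x : is_derive x 1 (fun x => expR (r * x)) (r * expR (r * x)).
Proof.
have e : is_derive x 1 (fun x => r * x) r.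
  by have := is_deriveZ r (is_derive_id x 1); rewrite -[r%:A]/(r * 1) mulr1.
by have := @is_derive1_comp R expR (fun x => r * x) x _ _ (is_derive_expR (r * x)) e; rewrite mulrC.
Qed.

Lemma jet_expj r : jet (expj r).
Proof.
move=> n x; have := is_deriveZ (r ^+ n) (is_derive_expM r x).
by rewrite -[_ *: _]/(_ * _) /expj mulrA -exprSr.
Qed.

(** Leibniz rule for $xe^{rx}$; at [n = 0] the truncated predecessor is harmless because its
    coefficient is 0. *)
Definition idexpj r : nat -> R -> R :=
  fun n x => r ^+ n * (x * expR (r * x)) + n%:R * r ^+ n.-1 * expR (r * x).

Lemma jet_idexpj r : jet (idexpj r).
Proof.
move=> n x; have d1 := is_derive_expM r x.
have d2 := is_deriveM (is_derive_id x 1) d1.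
have := is_derive_lin (r ^+ n) (n%:R * r ^+ n.-1) d2 d1.
congr (is_derive _ _ _ _).
rewrite /idexpj -[x *: _]/(x * _) -[(expR _)%:A]/(expR _ * 1) /=.
by case: n => [|n] /=; rewrite ?expr0 ?exprS -?natr1 /=; ring.
Qed.

(** By the mean value theorem the next derivative has zeros arbitrarily close to each point,
    endpoints included, and continuity concludes. *)
Lemma jet_zero d a b : a < b -> jet d -> (forall x, a <= x <= b -> d 0%N x = 0) ->
  forall n x, a <= x <= b -> d n x = 0.
Proof.
move=> ab jd d0; elim=> [//|n IHn] x xab; apply/eqP; apply: contraT => v0.
have v_gt0 : 0 < `|d n.+1 x| by rewrite normr_gt0.
have /cvgrPdist_lt /(_ _ v_gt0) [e /= e0 near_x] := jet_continuous (n := n.+1) jd (x := x).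
have nz y : `|x - y| < e -> d n.+1 y != 0.
  move=> /near_x /=; apply: contraTneq => ->; by rewrite subr0 ltxx.
have mvt y z : a <= y -> y < z -> z <= b -> exists2 c, y < c < z & d n.+1 c = 0.
  move=> ay yz zb.
  have [|c cyz] := @MVT R (d n) (d n.+1) y z yz (fun x _ => jd n x).
    by apply: continuous_subspaceT; exact: jet_continuous.
  rewrite !IHn ?ay ?zb ?(le_trans ay (ltW yz)) ?(le_trans (ltW yz) zb)// subrr => /esym/eqP.
  rewrite mulf_eq0 subr_eq0 [z == y]gt_eqF// orbF => /eqP c0.
  by exists c => //; move: cyz; rewrite in_itv.
(* Zeros are sought to the right of [x], or to its left when [x] is [b]. *)
have [xb|xb] := ltP x b.
  have [|||c /andP[c1 c2] c0] := mvt x (Num.min b (x + e)).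
  - by case/andP: xab.
  - by rewrite lt_min xb ltrDl.
  - by rewrite ge_min lexx.
  have := nz c; rewrite c0 eqxx /= => h; apply: h.
  by move: c2; rewrite lt_min => /andP[_ ?]; rewrite ltr_norml; lra.
have [|||c /andP[c1 c2] c0] := mvt (Num.max a (x - e)) x.
- by rewrite le_max lexx.
- by rewrite gt_max; apply/andP; split; lra.
- by case/andP: xab.
have := nz c; rewrite c0 eqxx /= => h; apply: h.
by move: c1; rewrite gt_max => /andP[_ ?]; rewrite ltr_norml; lra.
Qed.

(* The characteristic roots [+-s] and [+-q] may coincide. *)
Lemma fundamental_solution s q : 0 < s -> 0 < q -> exists d, [/\ jet d,
  forall x, d 4%N x = (s ^+ 2 + q ^+ 2) * d 2%N x - s ^+ 2 * q ^+ 2 * d 0%N x,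
  d 0%N 0 = 0, d 1%N 0 = 0 & d 2%N 0 = 0 /\ d 3%N 0 = 1].
Proof.
move=> s0 q0; have sn0 := lt0r_neq0 s0; have qn0 := lt0r_neq0 q0.
have [<-|sq] := eqVneq s q.
  (* Double roots: $d(x)=x\cosh(sx)/(2s^2)-\sinh(sx)/(2s^3)$. *)
  pose d n x := (4 * s ^+ 2)^-1 * (1 * idexpj s n x + 1 * idexpj (- s) n x)
    + (- (4 * s ^+ 3)^-1) * (1 * expj s n x + (-1) * expj (- s) n x).
  have jd : jet d.
    by apply: jet_lin; apply: jet_lin; (exact: jet_expj || exact: jet_idexpj).
  exists d; split; rewrite /d /idexpj /expj /= ?(mulr0, mul0r, expR0) //.
  - by move=> x; field.
  - by field.
  - by field.
  - by split; field.
have D0 : q ^+ 2 - s ^+ 2 != 0.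
  rewrite subr_sqr mulf_neq0//; first by rewrite subr_eq0 eq_sym.
  by rewrite gt_eqF// addr_gt0.
(* Distinct roots: $d(x)=(\sinh(qx)/q-\sinh(sx)/s)/(q^2-s^2)$. *)
pose d n x := ((q ^+ 2 - s ^+ 2) * (2 * q))^-1 * (1 * expj q n x + (-1) * expj (- q) n x)
   + (- ((q ^+ 2 - s ^+ 2) * (2 * s))^-1) * (1 * expj s n x + (-1) * expj (- s) n x).
have jd : jet d by apply: jet_lin; apply: jet_lin; exact: jet_expj.
exists d; split; rewrite /d /expj /= ?(mulr0, mul0r, expR0) //.
- by move=> x; field; rewrite D0 sn0.
- by field; rewrite D0 sn0.
- by field; rewrite D0 sn0.
- by split; field; rewrite D0 sn0.
Qed.

End Jets.

(** * The transmission conditions at a prescribed rate *)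

Section Transmission.
Variable R : realType.
Implicit Types (d e p m : nat -> R -> R) (r s q x k : R).

Lemma jet_unique d e : jet d -> jet e -> (forall x, d 0%N x = e 0%N x) ->
  forall n x, d n x = e n x.
Proof.
move=> jd je de0; elim=> [//|n /funext IHn] x.
have hd := jd n x; have he := je n x.
by rewrite -(@derive_val _ _ _ _ _ _ _ hd) -(@derive_val _ _ _ _ _ _ _ he) IHn.
Qed.

Lemma derive1n_jet d n : jet d -> derive1n n (d 0%N) = d n.
Proof.
move=> jd; elim: n => [//|n IHn]; rewrite derive1nS IHn; apply/funext => x.
by rewrite derive1E; have h := jd n x; rewrite derive_val.
Qed.

Lemma C4_jet (f : R -> R) : C4 f -> jet4 (fun n => Defs.D n f).
Proof.
move=> [df cf]; split; last exact: cf.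
move=> n n4 x.
by rewrite /Defs.D derive1nS derive1E; apply/derivableP; exact: df.
Qed.

Lemma jet_C4 d : jet d -> C4 (d 0%N).
Proof.
move=> jd; split=> [n _ x|]; last by rewrite derive1n_jet//; exact: jet_continuous.
by rewrite derive1n_jet//; have h := jd n x; exact: ex_derive.
Qed.

(** The characteristic polynomial is a multiple of $(X^2-\xi^2)(X^2-Q)$. The solution [d] and its
    derivative provide the two free constants left once value and slope vanish at a point. *)
Lemma ode_fundamental r k (B2 xi lam : R) : 0 < r -> 0 < k -> 0 < B2 -> xi != 0 ->
  0 < lam -> exists d, [/\ jet d, d 0%N 0 = 0, d 1%N 0 = 0, d 2%N 0 = 0 &
    [/\ d 3%N 0 = 1, d 4%N 0 = 0, forall x, ode r k B2 xi lam d x &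
    forall x, ode r k B2 xi lam (fun n => d n.+1) x]].
Proof.
move=> r0 k0 B0 xi0 lam0.
have al0 : 0 < k * lam + B2 by rewrite addr_gt0// mulr_gt0.
have xx : 0 < xi ^+ 2 by rewrite exprn_even_gt0.
pose Q := (k * lam * xi ^+ 2 + lam ^+ 2 * r) / (k * lam + B2).
have Q0 : 0 < Q.
  apply: divr_gt0 => //; apply: addr_gt0.
    exact: mulr_gt0 (mulr_gt0 k0 lam0) xx.
  exact: mulr_gt0 (exprn_gt0 2 lam0) r0.
have s0 : 0 < `|xi| by rewrite normr_gt0.
have q0 : 0 < Num.sqrt Q by rewrite sqrtr_gt0.
have [d [jd dE d0 d1 [d2 d3]]] := fundamental_solution s0 q0.
rewrite sqr_sqrtr ?ltW// real_normK ?num_real// in dE.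
(* Differentiates [dE]: both sides start jets that agree at order 0, hence at order 1. *)
have dE1 x : d 5 x = (xi ^+ 2 + Q) * d 3%N x - xi ^+ 2 * Q * d 1%N x.
  have jl := jet_lin (xi ^+ 2 + Q) (- (xi ^+ 2 * Q)) (jet_shift (jet_shift jd)) jd.
  have := jet_unique (jet_shift (jet_shift (jet_shift (jet_shift jd)))) jl _ 1 x.
  by rewrite /= mulNr; apply=> y; rewrite dE mulNr.
have QE : Q * (k * lam + B2) = k * lam * xi ^+ 2 + lam ^+ 2 * r.
  by rewrite /Q divfK// gt_eqF.
exists d; split=> //; split=> //.
- by rewrite dE d2 d0 !mulr0 subrr.
- move=> x; rewrite /ode dE; apply/eqP; rewrite -subr_eq0; apply/eqP.
  transitivity ((xi ^+ 2 * d 0%N x - d 2%N x) *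
    (Q * (k * lam + B2) - (k * lam * xi ^+ 2 + lam ^+ 2 * r))); first by ring.
  by rewrite QE subrr mulr0.
- move=> x; rewrite /ode dE1; apply/eqP; rewrite -subr_eq0; apply/eqP.
  transitivity ((xi ^+ 2 * d 1%N x - d 3%N x) *
    (Q * (k * lam + B2) - (k * lam * xi ^+ 2 + lam ^+ 2 * r))); first by ring.
  by rewrite QE subrr mulr0.
Qed.

Lemma ode_lin r k (B2 xi lam a b : R) d e x : ode r k B2 xi lam d x ->
  ode r k B2 xi lam e x -> ode r k B2 xi lam (fun n x => a * d n x + b * e n x) x.
Proof.
rewrite /ode => hd he.
transitivity (a * (- lam ^+ 2 * r * (xi ^+ 2 * d 0%N x - d 2%N x))
  + b * (- lam ^+ 2 * r * (xi ^+ 2 * e 0%N x - e 2%N x))); first by ring.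
by rewrite hd he; ring.
Qed.

(** Four unknowns and three equations: a matrix with 4 rows and 3 columns has a nonzero row
    kernel. *)
Lemma kernel_4_3 (al be ga de : 'I_3 -> R) : exists a b c f : R,
  (forall j, a * al j + b * be j + c * ga j + f * de j = 0) /\
  (a = 0 -> b = 0 -> c = 0 -> f = 0 -> False).
Proof.
pose A := \matrix_(i < 4, j < 3) nth 0 [:: al j; be j; ga j; de j] i.
have : kermx A != 0.
  by rewrite kermx_eq0 /row_free neq_ltn (leq_ltn_trans (rank_leq_col A)).
case/rowV0Pn => v /sub_kermxP vA vn0.
exists (v 0 0), (v 0 1), (v 0 2), (v 0 3); split.
  move=> j; have /rowP/(_ j) := vA; rewrite !mxE !big_ord_recl big_ord0 addr0 !mxE /=.
  rewrite !addrA => <-; do ![congr (_ + _)]; congr (v _ _ * _); exact: val_inj.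
move=> v0 v1 v2 v3; case/eqP: vn0; apply/rowP => i; rewrite mxE.
by case: i => [[|[|[|[|//]]]]] hi; [rewrite -[RHS]v0|rewrite -[RHS]v1|
  rewrite -[RHS]v2|rewrite -[RHS]v3]; congr (v _ _); exact: val_inj.
Qed.

(** Everything in the problem except the last jump condition. *)
Definition transmission rp rm mp mm (B2 xi lam : R) p m :=
  [/\ forall x, 0 < x < 1 -> ode rp mp B2 xi lam p x,
      forall x, -1 < x < 0 -> ode rm mm B2 xi lam m x,
      p 0%N 0 = m 0%N 0, p 1%N 0 = m 1%N 0 &
      moment mp B2 xi lam p 0 = moment mm B2 xi lam m 0] /\
  [/\ m 0%N (-1) = 0, m 1%N (-1) = 0, p 0%N 1 = 0 & p 1%N 1 = 0].

Section loaded.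
Variables (rp rm mp mm B2 xi lam : R).
Hypotheses (rm0 : 0 < rm) (rmp : rm < rp) (mp0 : 0 < mp) (mm0 : 0 < mm) (B20 : 0 < B2).
Hypotheses (lam0 : 0 < lam).

Let En := energy rp rm mp mm B2 xi lam.

Lemma transmission_H02 p m : jet4 p -> jet4 m -> transmission rp rm mp mm B2 xi lam p m ->
  H02_with (glue0 (m 0%N) (p 0%N)) (glue0 (m 1%N) (p 1%N)) (glue0 (m 2%N) (p 2%N)).
Proof. by move=> jp jm [[_ _ ? ? _] [? ? ? ?]]; exact: H02_glue. Qed.

Lemma energy_eq0 u u1 u2 : H02_with u u1 u2 -> En u u1 u2 u u1 u2 <= 0 ->
  forall x, -1 <= x <= 1 -> u x = 0.
Proof.
move=> hu E0; have [h h1 h2] := H02_L2 hu.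
apply: (primitive_eq0 h1 hu.2.1).
have := energy_ge (mp := mp) (mm := mm) (B2 := B2) xi (lam := lam)
  rm0 rmp mp0 mm0 B20 u2 (ltW lam0) h h1.
move=> /le_trans /(_ E0); rewrite mulrA pmulr_rle0//.
by rewrite mulr_gt0// exprn_gt0.
Qed.

(* The second and third derivatives at [-1] and [1] are four free constants,
   subject to three jump conditions. *)
Lemma loaded_solution : xi != 0 -> exists p m, [/\ jet p, jet m,
  transmission rp rm mp mm B2 xi lam p m &
  0 < En (glue0 (m 0%N) (p 0%N)) (glue0 (m 1%N) (p 1%N)) (glue0 (m 2%N) (p 2%N))
         (glue0 (m 0%N) (p 0%N)) (glue0 (m 1%N) (p 1%N)) (glue0 (m 2%N) (p 2%N))].
Proof.
move=> xi0; have rp0 : 0 < rp by exact: lt_trans rmp.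
have [d [jd d0 d1 d2 [d3 d4 od od']]] := ode_fundamental rp0 mp0 B20 xi0 lam0.
have [e [je e0 e1 e2 [e3 e4 oe oe']]] := ode_fundamental rm0 mm0 B20 xi0 lam0.
(* [D] and [D'] meet the boundary conditions at 1, and [E] and [E'] those at -1. *)
pose D := fun n x => d n (x + -1); pose D' := fun n x => d n.+1 (x + -1).
pose E := fun n x => e n (x + 1); pose E' := fun n x => e n.+1 (x + 1).
have jD : jet D by exact: jet_translate.
have jD' : jet D' by exact: (jet_translate (-1) (jet_shift jd)).
have jE : jet E by exact: jet_translate.
have jE' : jet E' by exact: (jet_translate 1 (jet_shift je)).
(* The three quantities to be matched at 0; the minus signs below put the lower side on the other
   side of the equation. *)
pose sel k B2 (q : nat -> R -> R) (j : 'I_3) :=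
  nth 0 [:: q 0%N 0; q 1%N 0; moment k B2 xi lam q 0] j.
have [a [b [c [f [eqs nz]]]]] := kernel_4_3 (sel mp B2 D') (sel mp B2 D)
  (fun j => - sel mm B2 E' j) (fun j => - sel mm B2 E j).
pose p n x := a * D' n x + b * D n x; pose m n x := c * E' n x + f * E n x.
have jp : jet p by exact: jet_lin.
have jm : jet m by exact: jet_lin.
have tr : transmission rp rm mp mm B2 xi lam p m.
  split; split.
  - by move=> x _; apply: ode_lin; [exact: od'|exact: od].
  - by move=> x _; apply: ode_lin; [exact: oe'|exact: oe].
  - by have := eqs 0; rewrite /sel /= /p /m => h; lra.
  - by have := eqs 1; rewrite /sel /= /p /m => h; lra.
  - by have := eqs 2; rewrite /sel /= /moment /p /m => h; lra.
  - by rewrite /m /E /E' addNr e0 e1; lra.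
  - by rewrite /m /E /E' addNr e1 e2; lra.
  - by rewrite /p /D /D' subrr d0 d1; lra.
  - by rewrite /p /D /D' subrr d1 d2; lra.
exists p, m; split=> //; rewrite ltNge; apply/negP.
(* Zero energy kills both pieces with all their derivatives, whereas the second and third
   derivatives at 1 and -1 return the four coefficients. *)
move=> /(energy_eq0 (transmission_H02 (jet_jet4 jp) (jet_jet4 jm) tr)) w0.
have p0 : forall n x, 0 <= x <= 1 -> p n x = 0.
  apply: jet_zero => // x /andP[x0 x1].
  (* At 0 the glued function takes the value of [m], which is also that of [p]. *)
  have [xn|xp] := leP x 0.
    have -> : x = 0 by lra.
    by case: tr => [[_ _ -> _ _] _]; rewrite -[LHS](@glue0_neg _ _ (p 0%N))// w0//; lra.
  by rewrite -[LHS](@glue0_pos _ (m 0%N))// w0//; lra.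
have m0 : forall n x, -1 <= x <= 0 -> m n x = 0.
  apply: jet_zero => // x /andP[x1 x0].
  by rewrite -[LHS](@glue0_neg _ _ (p 0%N))// w0//; lra.
apply: nz.
- have := p0 2%N 1; rewrite /p /D /D' subrr d3 d2; lra.
- have := p0 3%N 1; rewrite /p /D /D' subrr d4 d3; lra.
- have := m0 2%N (-1); rewrite /m /E /E' addNr e3 e2; lra.
- have := m0 3%N (-1); rewrite /m /E /E' addNr e4 e3; lra.
Qed.

End loaded.

End Transmission.

(** * The growth rate *)

Section GrowthRate.
Variable R : realType.
Variables (rp rm mp mm B2 xi : R).
Hypotheses (rm0 : 0 < rm) (rmp : rm < rp) (mp0 : 0 < mp) (mm0 : 0 < mm) (B20 : 0 < B2).
Implicit Types (u : R -> R) (lam c L th : R).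

Let En lam u u1 u2 := energy rp rm mp mm B2 xi lam u u1 u2 u u1 u2.
Let Kn u u1 := kinetic (step rm rp) xi u u1 u u1.
Let Vn u u1 u2 := viscous (step mm mp) xi u u1 u2 u u1 u2.
Let Mn u1 u2 := magnetic xi u1 u2 u1 u2.

Let EnE lam u u1 u2 : En lam u u1 u2 = lam ^+ 2 * Kn u u1 + lam * Vn u u1 u2 + B2 * Mn u1 u2.
Proof. by []. Qed.

Let Kn_ge0 u u1 : 0 <= Kn u u1. Proof. exact: kinetic_ge0. Qed.
Let Vn_ge0 u u1 u2 : 0 <= Vn u u1 u2. Proof. exact: viscous_ge0. Qed.
Let Mn_ge0 u1 u2 : 0 <= Mn u1 u2. Proof. exact: magnetic_ge0. Qed.

(** Continuity in the rate, made explicit: raising the rate by [t <= 1] adds at most [t * (S - 1)]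
    to the energy; the 1 in [S] makes the final inequality strict. *)
Lemma energy_open c L u u1 u2 : 0 <= L -> En L u u1 u2 < c ->
  exists2 lam, L < lam & En lam u u1 u2 < c.
Proof.
rewrite EnE => L0 Ec; have := Kn_ge0 u u1; have := Vn_ge0 u u1 u2.
move: Ec; set A := Kn _ _; set V := Vn _ _ _; set M := B2 * _ => Ec V0 A0.
pose gap := c - (L ^+ 2 * A + L * V + M); have gap0 : 0 < gap by rewrite /gap; lra.
pose S := 2 * L * A + V + A + 1.
have S0 : 0 < S by rewrite /S; have := mulr_ge0 L0 A0; lra.
pose t := Num.min 1 (gap / S).
have t0 : 0 < t by rewrite lt_min ltr01 divr_gt0.
have t1 : t <= 1 by rewrite ge_min lexx.
have tS : t * S <= gap by rewrite -ler_pdivlMr// ge_min lexx orbT.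
exists (L + t); first by rewrite ltrDl.
rewrite EnE -/A -/V -/M.
have tA : t ^+ 2 * A <= t * A by rewrite ler_wpM2r// expr2 ler_piMr// ltW.
have : (L + t) ^+ 2 * A + (L + t) * V + M =
  (L ^+ 2 * A + L * V + M) + t * S + (t ^+ 2 * A - t * A) - t by rewrite /S; ring.
by move=> ->; move: tS; rewrite /gap; lra.
Qed.

(** The energy has degree 2 in the rate with nonnegative coefficients, and [th ^+ 2 <= th <= 1]. *)
Lemma energy_scale th lam u u1 u2 : 0 <= th <= 1 -> 0 <= lam ->
  th ^+ 2 * En lam u u1 u2 <= En (th * lam) u u1 u2.
Proof.
move=> /andP[th0 th1] lam0; rewrite !EnE.
have th2 : th ^+ 2 <= th by rewrite expr2 ler_piMr.
have th21 : th ^+ 2 <= 1 by exact: le_trans th2 th1.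
rewrite -subr_ge0 [leRHS](_ : _ = (th - th ^+ 2) * (lam * Vn u u1 u2)
  + (1 - th ^+ 2) * (B2 * Mn u1 u2)); last by ring.
by rewrite addr_ge0// !mulr_ge0 ?subr_ge0 ?Vn_ge0 ?Mn_ge0// ltW.
Qed.

(** In the application [c] is $g[\rho]\xi^2$. The hypothesis on [u] is instability at rate 0, which
    makes the set of rates nonempty. *)
Lemma growth_rate c u u1 u2 : 0 < c -> xi != 0 -> H02_with u u1 u2 ->
  B2 * Mn u1 u2 < c * u 0 ^+ 2 ->
  exists lam p m, [/\ 0 < lam, jet p, jet m, transmission rp rm mp mm B2 xi lam p m &
    force rp mp B2 xi lam p 0 - force rm mm B2 xi lam m 0 = c * m 0%N 0 /\ m 0%N 0 != 0].
Proof.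
move=> c0 xi0 hu uM.
pose S : set R := [set lam | 0 < lam /\
  exists v v1 v2, H02_with v v1 v2 /\ En lam v v1 v2 < c * v 0 ^+ 2].
have E0 : En 0 u u1 u2 < c * u 0 ^+ 2 by rewrite EnE expr0n /= !mul0r !add0r.
have [lam1 lam10 Elam1] := energy_open (lexx 0) E0.
have S1 : S lam1 by split=> //; exists u, u1, u2.
(* The energy is at least [lam ^+ 2 * rm * J] and below [c * J], so [lam ^+ 2 * rm < c]; the added 1
   allows comparing [lam] with its square. *)
have Sub : ubound S (1 + c / rm).
  move=> lam [lam0 [v [v1 [v2 [hv Ev]]]]].
  have [h h1 h2] := H02_L2 hv.
  have e1 := energy_ge (mp := mp) (mm := mm) (B2 := B2) xi (lam := lam)
    rm0 rmp mp0 mm0 B20 v2 (ltW lam0) h h1.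
  have e2 := sqr_origin_le hv.
  have e3 := le_lt_trans e1 (lt_le_trans Ev (ler_wpM2l (ltW c0) e2)).
  move: e3; set J := Int _ _ _ => e3.
  have J0 : 0 <= J by apply: Int_ge0 => x _; exact: sqr_ge0.
  have e4 : lam ^+ 2 * rm < c.
    rewrite ltNge; apply/negP => e4; have := ler_wpM2r J0 e4.
    by rewrite -mulrA leNgt e3.
  rewrite leNgt; apply/negP => e5.
  have lam_gt1 : 1 <= lam by apply: ltW; apply: le_lt_trans e5; rewrite lerDl divr_ge0// ltW.
  have : c / rm < lam by apply: le_lt_trans e5; rewrite lerDr.
  rewrite ltr_pdivrMr// => /lt_trans /(_ _) e6.
  have : lam * rm <= lam ^+ 2 * rm by rewrite ler_pM2r// expr2 ler_peMr// ltW.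
  move=> /le_lt_trans /(_ e4) e7.
  by have := e6 _ e7; rewrite ltxx.
have hasS : has_sup S by split; [exists lam1|exists (1 + c / rm)].
pose L := sup S.
have SL lam : S lam -> lam <= L by move=> Slam; apply: sup_ubound => //; case: hasS.
have L0 : 0 < L by exact: lt_le_trans lam10 (SL _ S1).
have [p [m [jp jm tr Ew]]] := loaded_solution rm0 rmp mp0 mm0 B20 L0 xi0.
exists L, p, m; split=> //.
have hw := transmission_H02 (jet_jet4 jp) (jet_jet4 jm) tr.
move: Ew hw; set w := glue0 (m 0%N) _; set w1 := glue0 (m 1%N) _; set w2 := glue0 (m 2%N) _.
move=> Ew hw.
set K := force _ _ _ _ _ _ _ - _.
(* Against [w] the form is [K] times evaluation at 0. Positivity of the energy of [w] then forces
   [w 0 != 0]. *)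
have Kw v v1 v2 : H02_with v v1 v2 -> energy rp rm mp mm B2 xi L w w1 w2 v v1 v2 = K * v 0.
  by move=> hv; case: tr => [[? ? ? ? ?] _]; apply: weak_form => //; exact: jet_jet4.
have w0E : w 0 = m 0%N 0 by rewrite /w glue0_neg.
rewrite -w0E; move: Ew; rewrite Kw// => Ew.
have w0 : w 0 != 0 by apply: contraTneq Ew => ->; rewrite mulr0 ltxx.
split=> //.
pose kap := K / w 0; have KE : K = kap * w 0 by rewrite /kap divfK.
have kap0 : 0 < kap.
  have : 0 < kap * w 0 ^+ 2 by rewrite expr2 mulrA -KE.
  by rewrite pmulr_lgt0// exprn_even_gt0.
(* Nonnegativity of the energy of [v - t w], which vanishes at 0. *)
have low v v1 v2 : H02_with v v1 v2 -> kap * v 0 ^+ 2 <= En L v v1 v2.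
  move=> hv; pose t := v 0 / w 0.
  have [h h1 h2] := H02_L2 hw; have [k k1 k2] := H02_L2 hv.
  have := energy_sub rp rm mp mm B2 xi L t h h1 h2 k k1 k2.
  have := energy_ge0 xi rm0 rmp mp0 mm0 B20 (fun x => v x - t * w x)
     (fun x => v1 x - t * w1 x) (fun x => v2 x - t * w2 x) (ltW L0).
  move=> /[swap] /= ->; rewrite !Kw// -/(En L v v1 v2) KE.
  have -> : v 0 = t * w 0 by rewrite /t divfK.
  move=> H; rewrite -subr_ge0; apply: le_trans H _.
  by rewrite le_eqVlt; apply/orP; left; apply/eqP; ring.
suff -> : c = kap by exact: KE.
apply/eqP; rewrite eq_le; apply/andP; split; rewrite leNgt; apply/negP => kc.
(* If [kap < c], then [w] is unstable at [L], hence at some larger rate. *)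
- have EL : En L w w1 w2 < c * w 0 ^+ 2.
    by rewrite /En Kw// KE -mulrA -expr2 ltr_pM2r// exprn_even_gt0.
  have [lam Llam Elam] := energy_open (ltW L0) EL.
  have : S lam by split; [exact: lt_trans Llam | exists w, w1, w2].
  by move=> /SL; rewrite leNgt Llam.
(* If [c < kap], this mean satisfies [th < 1] and [c <= th ^+ 2 * kap]. A rate of [S] above
   [th * L], compared with [L] by scaling, has all energies at least [c * v 0 ^+ 2], a
   contradiction. *)
- pose th := (1 + c / kap) / 2.
  have ck1 : c / kap < 1 by rewrite ltr_pdivrMr// mul1r.
  have ck0 : 0 < c / kap by rewrite divr_gt0.
  have th1 : th < 1 by rewrite /th; lra.
  have th0 : 0 < th by rewrite /th; lra.
  have cth : c <= th ^+ 2 * kap.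
    rewrite -ler_pdivrMr// /th; have := sqr_ge0 (1 - c / kap); lra.
  have e0 : 0 < L - th * L by rewrite subr_gt0 gtr_pMl.
  have [lam Slam] := sup_adherent e0 hasS.
  rewrite -/L subKr => thlam.
  have lamL := SL _ Slam.
  case: Slam => lam0 [v [v1 [v2 [hv Ev]]]].
  have tl : 0 <= lam / L <= 1.
    by apply/andP; split; [apply: divr_ge0; exact: ltW|rewrite ler_pdivrMr// mul1r].
  have := energy_scale v v1 v2 tl (ltW L0); rewrite divfK ?gt_eqF// => e1.
  have e2 := ler_wpM2l (sqr_ge0 (lam / L)) (low _ _ _ hv).
  have := lt_le_trans (le_lt_trans (le_trans e2 e1) Ev) (ler_wpM2r (sqr_ge0 _) cth).
  have sq : th ^+ 2 <= (lam / L) ^+ 2.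
    rewrite ler_pXn2r//; [|by rewrite nnegrE ltW|by case/andP: tl].
    by rewrite ler_pdivlMr// ltW.
  rewrite [_ * (kap * _)]mulrA ltNge => /negP; apply.
  by rewrite ler_wpM2r ?sqr_ge0// ler_wpM2r// ltW.
Qed.

End GrowthRate.

(** * The transmission problem *)

Section Problem.
Variable R : realType.
Variables (g rp rm mp mm B : R).
Hypotheses (g0 : 0 < g) (rm0 : 0 < rm) (rmp : rm < rp) (mp0 : 0 < mp) (mm0 : 0 < mm).
Hypothesis B0 : B != 0.
Implicit Types (p m d : nat -> R -> R) (xi lam x : R).

Let B20 : 0 < `|B| ^+ 2. Proof. by rewrite exprn_gt0// normr_gt0. Qed.

(** A derivative depends only on values near the point, so agreement on the open interval passes
    from each order to the next. *)
Lemma smooth_on_jet d f a b : jet d -> (forall x, a < x < b -> f x = d 0%N x) ->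
  smooth_on a b f.
Proof.
move=> jd fd.
have dn n : forall x, a < x < b -> derive1n n f x = d n x /\
    is_derive x 1 (derive1n n f) (d n.+1 x).
  elim: n => [|n IHn] x xab.
    split; first exact: fd.
    apply: (@near_eq_is_derive _ _ _ (d 0%N) f) => //.
    apply: (@open_in_nearW _ _ `]a, b[); last by rewrite inE /= in_itv.
      exact: interval_open.
    by move=> y; rewrite inE /= in_itv /= => /fd.
  have E y : a < y < b -> derive1n n.+1 f y = d n.+1 y.
    move=> /IHn[_ h]; rewrite derive1nS derive1E; exact: derive_val.
  split; first exact: E.
  apply: (@near_eq_is_derive _ _ _ (d n.+1) (derive1n n.+1 f)) => //.
  apply: (@open_in_nearW _ _ `]a, b[); last by rewrite inE /= in_itv.
    exact: interval_open.
  by move=> y; rewrite inE /= in_itv /= => /E.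
by move=> n x /(dn n)[_ h]; exact: ex_derive.
Qed.

Lemma transmission_VSol xi lam p m : jet p -> jet m ->
  transmission rp rm mp mm (`|B| ^+ 2) xi lam p m ->
  force rp mp (`|B| ^+ 2) xi lam p 0 - force rm mm (`|B| ^+ 2) xi lam m 0 =
    g * (rp - rm) * xi ^+ 2 * m 0%N 0 ->
  VSol g rp rm mp mm B xi lam (glue0 (m 0%N) (p 0%N)).
Proof.
move=> jp jm [[op om e0 e1 e2] [m0 m1 p0 p1]] ef.
have Dp n : Defs.D n (p 0%N) = p n by exact: derive1n_jet.
have Dm n : Defs.D n (m 0%N) = m n by exact: derive1n_jet.
exists (p 0%N), (m 0%N); rewrite /ode_at !Dp !Dm.
have z : glue0 (m 0%N) (p 0%N) 0 = m 0%N 0 by rewrite glue0_neg.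
split; [exact: jet_C4|split; [exact: jet_C4|]].
do ![split].
- move=> x /andP[x0 _]; have [xn|/glue0_pos ->//] := leP x 0.
  have -> : x = 0 by apply: le_anti; rewrite xn.
  by rewrite z e0.
- by move=> x /andP[_ x0]; rewrite glue0_neg.
- exact: op.
- exact: om.
- by rewrite e0 subrr.
- by rewrite e1 subrr.
- by move: e2; rewrite /moment; lra.
- by move: ef; rewrite /force z; lra.
- by rewrite glue0_neg ?m0//; lra.
- by rewrite glue0_pos ?p0//; lra.
- exact: m1.
- exact: p1.
Qed.

Lemma VSol_transmission xi lam psi : VSol g rp rm mp mm B xi lam psi ->
  exists p m, [/\ jet4 p, jet4 m, transmission rp rm mp mm (`|B| ^+ 2) xi lam p m,
  force rp mp (`|B| ^+ 2) xi lam p 0 - force rm mm (`|B| ^+ 2) xi lam m 0 =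
    g * (rp - rm) * xi ^+ 2 * m 0%N 0 &
  forall x, -1 <= x <= 1 -> psi x = glue0 (m 0%N) (p 0%N) x].
Proof.
have b0 : -1 <= (0 : R) <= 0 by lra.
have bN : -1 <= (-1 : R) <= 0 by lra.
have b1 : 0 <= (1 : R) <= 1 by lra.
have abs p m : jet4 p -> jet4 m ->
    (forall x, 0 <= x <= 1 -> psi x = p 0%N x) ->
    (forall x, -1 <= x <= 0 -> psi x = m 0%N x) ->
    (forall x, 0 < x < 1 -> ode rp mp (`|B| ^+ 2) xi lam p x) ->
    (forall x, -1 < x < 0 -> ode rm mm (`|B| ^+ 2) xi lam m x) ->
    p 0%N 0 - m 0%N 0 = 0 -> p 1%N 0 - m 1%N 0 = 0 ->
    (mp * lam * (xi ^+ 2 * p 0%N 0 + p 2%N 0) + `|B| ^+ 2 * p 2%N 0)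
    - (mm * lam * (xi ^+ 2 * m 0%N 0 + m 2%N 0) + `|B| ^+ 2 * m 2%N 0) = 0 ->
    (mp * lam * (p 3%N 0 - 3 * xi ^+ 2 * p 1%N 0) + `|B| ^+ 2 * p 3%N 0)
    - (mm * lam * (m 3%N 0 - 3 * xi ^+ 2 * m 1%N 0) + `|B| ^+ 2 * m 3%N 0)
    = (lam ^+ 2 * rp * p 1%N 0 - lam ^+ 2 * rm * m 1%N 0)
      + g * (rp - rm) * xi ^+ 2 * psi 0 ->
    psi (-1) = 0 -> psi 1 = 0 -> m 1%N (-1) = 0 -> p 1%N 1 = 0 ->
    [/\ jet4 p, jet4 m, transmission rp rm mp mm (`|B| ^+ 2) xi lam p m,
    force rp mp (`|B| ^+ 2) xi lam p 0 - force rm mm (`|B| ^+ 2) xi lam m 0 =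
      g * (rp - rm) * xi ^+ 2 * m 0%N 0 &
    forall x, -1 <= x <= 1 -> psi x = glue0 (m 0%N) (p 0%N) x].
  move=> jp jm pp pm op om e0 e1 e2 e3 N0 P0 m1 p1.
  have z := pm _ b0; split=> //.
  - split; split=> //.
    + exact: subr0_eq e0.
    + exact: subr0_eq e1.
    + by move: e2; rewrite /moment; lra.
    + by rewrite -pm.
    + by rewrite -pp.
  - by move: e3; rewrite /force z; lra.
  - move=> x /andP[x1 x2]; have [x0|x0] := leP x 0.
      by rewrite glue0_neg// pm// x1.
    by rewrite glue0_pos// pp// ltW.
move=> [fp [fm [/C4_jet cp [/C4_jet cm [pp [pm [op [om
  [e0 [e1 [e2 [e3 [N0 [P0 [m1 p1]]]]]]]]]]]]]]].
exists (fun n => Defs.D n fp), (fun n => Defs.D n fm).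
exact: abs cp cm pp pm op om e0 e1 e2 e3 N0 P0 m1 p1.
Qed.

Lemma magneticE xi (u1 u2 : R -> R) : L2m11 u1 -> L2m11 u2 ->
  magnetic xi u1 u2 u1 u2 = xi ^+ 2 * Int (-1) 1 (fun x => u1 x ^+ 2)
    + Int (-1) 1 (fun x => u2 x ^+ 2).
Proof.
move=> h1 h2; rewrite -(IntZ (lexx _) (lexx _) _ h1.2) -IntD//.
- by apply: L1Z; exact: h1.2.
- exact: h2.2.
Qed.

(** The weak form tested against the solution itself, with the viscous term dropped and the kinetic
    one bounded below, leaving only integrals that enter the critical numbers. *)
Lemma VSol_energy xi lam psi : 0 < lam -> VSol g rp rm mp mm B xi lam psi ->
  exists u u1 u2, [/\ H02_with u u1 u2, forall x, -1 <= x <= 1 -> psi x = u x &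
  lam ^+ 2 * (rm * Int (-1) 1 (fun x => u1 x ^+ 2))
  + `|B| ^+ 2 * (xi ^+ 2 * Int (-1) 1 (fun x => u1 x ^+ 2)
                 + Int (-1) 1 (fun x => u2 x ^+ 2)) <=
  xi ^+ 2 * (g * (rp - rm) * u 0 ^+ 2)].
Proof.
move=> lam0 /VSol_transmission[p [m [jp jm tr ef psiE]]].
have hw := transmission_H02 jp jm tr.
exists (glue0 (m 0%N) (p 0%N)), (glue0 (m 1%N) (p 1%N)), (glue0 (m 2%N) (p 2%N)).
split=> //; have [h h1 h2] := H02_L2 hw.
have := weak_form jp jm _ _ _ _ hw; case: tr => [[op om _ e1 e2] _].
move=> /(_ _ _ _ _ _ _ _ op om e1 e2); rewrite ef.
rewrite -magneticE// /energy.
set k := kinetic _ _ _ _ _ _; set v := viscous _ _ _ _ _ _ _ _.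
have kJ := kinetic_ge xi rm0 rmp h h1; rewrite -/k in kJ.
have v0 : 0 <= v by exact: viscous_ge0.
have := ler_wpM2l (sqr_ge0 lam) kJ; have := mulr_ge0 (ltW lam0) v0.
rewrite [glue0 (m 0%N) (p 0%N) 0]glue0_neg//.
move=> H1 H2 H3.
have -> : xi ^+ 2 * (g * (rp - rm) * m 0%N 0 ^+ 2) =
    g * (rp - rm) * xi ^+ 2 * m 0%N 0 * m 0%N 0 by ring.
by rewrite -H3; lra.
Qed.

(** Common core of both nonexistence results: the kinetic term is strictly positive unless the
    derivative vanishes, so the stability inequality contradicts the energy bound. *)
Lemma VSol_trivial xi lam psi :
  (forall u u1 u2, H02_with u u1 u2 -> nonzero_on_m11 u ->
     0 < Int (-1) 1 (fun x => u1 x ^+ 2) ->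
     xi ^+ 2 * (g * (rp - rm) * u 0 ^+ 2) <=
     `|B| ^+ 2 * (xi ^+ 2 * Int (-1) 1 (fun x => u1 x ^+ 2)
                 + Int (-1) 1 (fun x => u2 x ^+ 2))) ->
  0 < lam -> VSol g rp rm mp mm B xi lam psi ->
  forall x, -1 <= x <= 1 -> psi x = 0.
Proof.
move=> stable lam0 /(VSol_energy lam0)[u [u1 [u2 [hu psiE E]]]] x xI.
rewrite psiE//; have [_ h1 _] := H02_L2 hu.
have [J0|J0] := leP (Int (-1) 1 (fun x => u1 x ^+ 2)) 0.
  exact: (primitive_eq0 h1 hu.2.1 J0).
apply/eqP; apply: contraT => ux.
have nz : nonzero_on_m11 u by exists x.
have := stable _ _ _ hu nz J0.
have : 0 < lam ^+ 2 * (rm * Int (-1) 1 (fun x => u1 x ^+ 2)).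
  by rewrite !mulr_gt0// exprn_gt0.
by move: E; lra.
Qed.

(** Here [u] competes in the supremum; multiply its bound by [xi ^+ 2] and add the nonnegative
    second-derivative term. *)
Lemma no_solution_strong_field : (Bc2 g (rp - rm) <= (`|B| ^+ 2)%:E)%E ->
  forall xi lam psi, 0 < lam -> VSol g rp rm mp mm B xi lam psi ->
  forall x, -1 <= x <= 1 -> psi x = 0.
Proof.
move=> Bc xi lam psi; apply: VSol_trivial => u u1 u2 hu nz J0.
have : ((g * (rp - rm) * u 0 ^+ 2 / Int (-1) 1 (fun x => u1 x ^+ 2))%:E <= Bc2 g (rp - rm))%E.
  apply: ereal_sup_ubound => /=; eexists; last reflexivity.
  exists u, u1; split=> //; split; last by case: hu.
  by have [] := H02_L2 hu.
move=> /le_trans /(_ Bc); rewrite lee_fin ler_pdivrMr// => h.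
have J2 : 0 <= Int (-1) 1 (fun x => u2 x ^+ 2) by apply: Int_ge0 => x _; exact: sqr_ge0.
have := ler_wpM2l (sqr_ge0 xi) h; have := mulr_ge0 (ltW B20) J2.
by rewrite mulrDr; lra.
Qed.

(** The required inequality bounds [xi ^+ 2 * den] by $|B|^2$ times [J2]: clear if [den <= 0], and
    otherwise [u] competes in the infimum. *)
Lemma no_solution_low_frequency xi : ((`|xi| ^+ 2)%:E <= xivc2 g (rp - rm) B)%E ->
  forall lam psi, 0 < lam -> VSol g rp rm mp mm B xi lam psi ->
  forall x, -1 <= x <= 1 -> psi x = 0.
Proof.
move=> low lam psi; apply: VSol_trivial => u u1 u2 hu nz J0.
set J1 := Int _ _ _; set J2 := Int _ _ _.
have J20 : 0 <= J2 by apply: Int_ge0 => x _; exact: sqr_ge0.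
pose den := g * (rp - rm) * u 0 ^+ 2 - `|B| ^+ 2 * J1.
have [den0|den0] := leP den 0.
  have := mulr_ge0 (ltW B20) J20; have := mulr_ge0_le0 (sqr_ge0 xi) den0.
  by rewrite /den; lra.
have : (xivc2 g (rp - rm) B <= (`|B| ^+ 2 * J2 / den)%:E)%E.
  apply: ereal_inf_lbound => /=; eexists; last reflexivity.
  by exists u, u1, u2.
move=> /(le_trans low); rewrite lee_fin ler_pdivlMr// real_normK ?num_real// /den.
by lra.
Qed.

(** A competitor with quotient below [xi ^+ 2] is precisely a function unstable at rate 0. *)
Lemma unstable_mode xi : (xivc2 g (rp - rm) B < (`|xi| ^+ 2)%:E)%E ->
  exists lam psi, [/\ 0 < lam, VSol g rp rm mp mm B xi lam psi,
    smooth_on (-1) 0 psi, smooth_on 0 1 psi & psi 0 != 0].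
Proof.
rewrite real_normK ?num_real// => /ereal_inf_lt[_ [r [u [u1 [u2 [hu [den0 ->]]]]] <-]].
rewrite lte_fin ltr_pdivrMr//.
have [_ h1 h2] := H02_L2 hu.
move: den0; set J1 := Int _ _ _ => den0; set J2 := Int _ _ _ => hxi.
have J20 : 0 <= J2 by apply: Int_ge0 => x _; exact: sqr_ge0.
have xi0 : xi != 0.
  apply: contraTneq hxi => ->; rewrite expr0n /= mul0r -leNgt.
  exact: mulr_ge0 (ltW B20) J20.
have c0 : 0 < g * (rp - rm) * xi ^+ 2.
  have x2 : 0 < xi ^+ 2 by rewrite exprn_even_gt0.
  by apply: mulr_gt0 x2; apply: mulr_gt0 => //; rewrite subr_gt0.
have [] := growth_rate rm0 rmp mp0 mm0 B20 c0 xi0 hu.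
  by rewrite magneticE// -/J1 -/J2; lra.
move=> lam [p [m [lam0 jp jm tr [ef w0]]]].
exists lam, (glue0 (m 0%N) (p 0%N)); split=> //.
- exact: transmission_VSol.
- by apply: (smooth_on_jet jm) => x /andP[_ x0]; rewrite glue0_neg// ltW.
- by apply: (smooth_on_jet jp) => x /andP[x0 _]; rewrite glue0_pos.
- by rewrite glue0_neg.
Qed.

End Problem.

Theorem theorem2p1 (R : realType) (g rp rm mp mm B : R) :
  0 < g -> 0 < rm -> rm < rp -> 0 < mp -> 0 < mm -> B != 0 ->
  (* (i) *)
  ((Bc2 g (rp - rm) <= (`|B| ^+ 2)%:E)%E ->
    (forall xi lam psi, 0 < lam -> VSol g rp rm mp mm B xi lam psi ->
       forall x, -1 <= x <= 1 -> psi x = 0)) /\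
  (* (ii) *)
  (((`|B| ^+ 2)%:E < Bc2 g (rp - rm))%E ->
    (forall xi, ((`|xi| ^+ 2)%:E <= xivc2 g (rp - rm) B)%E ->
     forall lam psi, 0 < lam -> VSol g rp rm mp mm B xi lam psi ->
       forall x, -1 <= x <= 1 -> psi x = 0)) /\
  (* (iii) *)
  (((`|B| ^+ 2)%:E < Bc2 g (rp - rm))%E ->
    exists (lam : R -> R) (psi : R -> R -> R),
      forall xi, (xivc2 g (rp - rm) B < (`|xi| ^+ 2)%:E)%E ->
        0 < lam xi /\ VSol g rp rm mp mm B xi (lam xi) (psi xi) /\
        lam (- xi) = lam xi /\ psi (- xi) = psi xi /\
        smooth_on (-1) 0 (psi xi) /\ smooth_on 0 1 (psi xi) /\
        psi xi 0 != 0).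
Proof.
move=> g0 rm0 rmp mp0 mm0 B0; split; [|split].
- exact: no_solution_strong_field.
- by move=> _; exact: no_solution_low_frequency.
- move=> _.
  have /choice[F FP] : forall xi : R, exists lp : R * (R -> R),
      (xivc2 g (rp - rm) B < (`|xi| ^+ 2)%:E)%E ->
      [/\ 0 < lp.1, VSol g rp rm mp mm B xi lp.1 lp.2,
        smooth_on (-1) 0 lp.2, smooth_on 0 1 lp.2 & lp.2 0 != 0].
    move=> xi; have [h|h] := pselect ((xivc2 g (rp - rm) B < (`|xi| ^+ 2)%:E)%E).
      have [lam [psi P]] := unstable_mode g0 rm0 rmp mp0 mm0 B0 h.
      by exists (lam, psi).
    (* Default at frequencies where nothing is claimed. *)
    by exists (0, fun=> 0).
  (* Choosing at the absolute value makes rate and mode even; the problem itself contains only even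
     powers of [xi]. *)
  exists (fun xi => (F `|xi|).1), (fun xi => (F `|xi|).2) => xi hxi.
  have [|l0 V s1 s2 p0] := FP `|xi|; first by rewrite normr_id.
  have x2 : `|xi| ^+ 2 = xi ^+ 2 by rewrite real_normK ?num_real.
  have x4 : `|xi| ^+ 4 = xi ^+ 4 by rewrite (exprM `|xi| 2 2) x2 -exprM.
  rewrite normrN; do ![split=> //].
  by move: V; rewrite /VSol /ode_at x2 x4.
Qed.
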